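(* Let $$L(x)=\ell x+\lambda,\qquad U(x)=ux+\mu,\qquad V(x)=vx+\nu$$ be primitive nonconstant polynomials in $\mathbb{Z}[x]$, and suppose that they are pairwise nonassociate. Let $\gamma,\delta\in\mathbb{Z}\setminus\{0\}$, let $r_L,r_U,s_L,s_V$ be positive integers, and put $$F=\gamma L^{r_L}U^{r_U},\qquad G=\delta L^{s_L}V^{s_V}.$$ Then $$\mathcal{P}(F,G)\quad\Longleftrightarrow\quad \gcd(|u|,|v|)=1\ \text{ and }\ \min\{\gcd(|\ell|,|u|),\gcd(|\ell|,|v|)\}=1.$$ Equivalently, $\mathcal{P}(F,G)$ holds if and only if $UV$ and at least one of $F,G$ are intersective.
   Context: $\mathbb{N}=\{1,2,\ldots\}$. For $A\subset\mathbb{N}$ and $m\in\mathbb{Z}$, put $d_A(m)=\#\{a\in A: a\mid m\}$, which may be infinite (in particular $d_A(0)=|A|$). For $u,v\in\mathbb{Z}$ define $\delta_A(u,v)=0$ if $u=v=0$; $\delta_A(u,v)=\infty$ if exactly one of $u,v$ is zero; $\delta_A(u,v)=|d_A(u)-d_A(v)|$ if $uv\neq 0$. For $F,G\in\mathbb{Z}[x]$, $\mathcal{P}(F,G)$ denotes the property: for every infinite $A\subset\mathbb{N}$, $\limsup_{n\to\infty}\delta_A(F(n),G(n))=\infty$ ($n$ running over positive integers). A polynomial $H\in\mathbb{Z}[x]$ is intersective if for every integer $m\ge 1$ there exists $n\in\mathbb{Z}$ with $H(n)\equiv 0\pmod m$. Two polynomials in $\mathbb{Z}[x]$ are associate if they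 differ by a factor $\pm1$. *)

(* Defs.v *)
From mathcomp Require Import all_boot all_order all_algebra.
From mathcomp Require Import boolp classical_sets cardinality reals ereal.
From mathcomp Require Import topology normedtype sequences measure.
Set Implicit Arguments.
Unset Strict Implicit.
Unset Printing Implicit Defensive.
Import Order.TTheory GRing.Theory Num.Theory.
Local Open Scope classical_set_scope.
Local Open Scope ring_scope.

(* [counting] is the cardinality of a set as an extended real, +oo if the set
   is infinite; hence dvd_count A 0 = |A|. *)
Definition dvd_count (R : realType) (A : set nat) (m : int) : \bar R :=
  counting [set a : nat | A a /\ (a%:Z %| m)%Z].

Definition dvd_delta (R : realType) (A : set nat) (x y : int) : \bar R :=
  if (x == 0) && (y == 0) then 0%E
  else if (x == 0) || (y == 0) then +oo%E
  else `|dvd_count R A x - dvd_count R A y|%E.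

(* Both the elements of A and the arguments of F and G are positive integers;
   the sequence index k stands for n = k + 1. *)
Definition propP (R : realType) (F G : {poly int}) : Prop :=
  forall A : set nat, A `<=` [set a | (0 < a)%N] -> infinite_set A ->
    limn_esup (fun k : nat => dvd_delta R A F.[k.+1%:Z] G.[k.+1%:Z]) = +oo%E.

Definition intersective (H : {poly int}) : Prop :=
  forall m : nat, (0 < m)%N -> exists n : int, (m%:Z %| H.[n])%Z.

(* This is association in Z[x]; the library's %= on {poly int} allows
   arbitrary nonzero integer factors on both sides. *)
Definition associate (P Q : {poly int}) : Prop := P = Q \/ P = - Q.

(* [zcontents] carries the sign of the leading coefficient. *)
Definition primitive (P : {poly int}) : Prop := `|zcontents P|%N = 1%N.

Definition nonconstant (P : {poly int}) : Prop := (1 < size P)%N.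

(* Main.v *)
From mathcomp Require Import boolp classical_sets cardinality reals ereal.
From mathcomp Require Import topology normedtype sequences measure finmap.
Require Import Defs.
From mathcomp Require Import all_boot all_order all_algebra.
From mathcomp Require Import zify ring lra.
Set Implicit Arguments.
Unset Strict Implicit.
Unset Printing Implicit Defensive.
Import Order.TTheory GRing.Theory Num.Theory.
Local Open Scope ring_scope.

(** Intersectivity is a matter of local solvability: by the Chinese remainder
    theorem a product of powers of two primitive linear polynomials is
    intersective exactly when no prime divides both leading coefficients
    ([intersective_linprod]). So the two criteria of the theorem agree, and the
    work lies in relating them to the counts [count_in A m] of the elements of
    [A] that divide [m].

    Necessity. If g > 1 divides l and u, then L(n) and U(n) are prime to g, so
    only boundedly many powers of g divide F(n); if moreover h > 1 divides l
    and v, then only boundedly many powers of gh divide F(n) or G(n)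
    ([bounded_powers]). If a prime p divides u and v, then the p-adic
    valuations of F(n) and G(n) are affine functions of that of L(n) with
    positive slopes. Two such functions are comparable up to constants, and a
    set of powers of p whose exponents grow geometrically enough does not tell
    them apart, up to a bounded error ([bounded_sparse]).

    Sufficiency. By symmetry u is prime to l and v. Write each a in A as the
    product of its u-part (the part at the primes of u) and the rest.

    If some u-part s is shared by infinitely many a in A, then n is chosen such
    that L(n) is divisible by s and U(n) by the rest of many such a, so that
    these a all divide F(n). At the primes dividing a, u or the resultants the
    values L(n) and V(n) have bounded parts, because U(n) is divisible by high
    powers of those prime to u, L(n) has a prescribed residue at those of u,
    and the cross combinations of the three forms are constant
    ([local_choice]). The remaining factors of L(n) and V(n) are made to have a
    bounded number of divisors by a sieve ([almost_prime_values]). Then G(n)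
    has boundedly many divisors in all ([separated_part_infinite]).

    If every u-part occurs finitely often, no sieve is needed: a bound on the
    u-part of a number leaves finitely many candidates in A for its divisors.
    Let R1 and R2 be the resultants of U with L and with V. When infinitely
    many a have a rest that divides the constant E = |del R1^sL R2^sV|, these
    are made to divide G(n) by taking V(n) divisible by a power of u, while the
    u-part of F(n) is bounded ([separated_via_G]). Otherwise many elements of A
    are made to divide F(n), and the finitely many candidates with admissible
    u-part are forced out of G(n), up to the finitely many whose rest divides E
    ([separated_via_F]).

    The sieve is Selberg's, applied to P(t) = (a t + b)(c t + d) and restricted
    to the primes up to 2^D. The square of a combination W of products of
    independent mean-zero functions psi_p serves as a weight for t below 2^(50
    D). Truncating by the sum of the rounded-up binary logarithms of the
    primes, instead of by their product, keeps everything additive in small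
    integers. On the event p | P(t) the weight loses a factor of about (log p /
    D)^2 on average, so the weighted mean of the number of prime divisors of
    P(t) is bounded by an absolute constant, thanks to Chebyshev's bound for
    the primes in dyadic windows. *)

(** * Means of periodic functions *)

Section Mean.
Variable K : realFieldType.
Implicit Types (f g : nat -> K) (a b q T : nat).

Definition periodic q f := forall t, f (t + q)%N = f t.

Definition mean q f : K := (\sum_(0 <= t < q) f t) / q%:R.

Lemma periodic_mul k q f : periodic q f -> periodic (k * q) f.
Proof.
move=> fq; elim: k => [|k IH] t; first by rewrite mul0n addn0.
by rewrite mulSn addnA IH fq.
Qed.

Lemma periodicM q f g :
  periodic q f -> periodic q g -> periodic q (fun t => f t * g t).
Proof. by move=> fq gq t; rewrite fq gq. Qed.

Lemma periodic_modn q f t : periodic q f -> f (t %% q)%N = f t.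
Proof.
by move=> fq; rewrite {2}(divn_eq t q) addnC (periodic_mul (t %/ q) fq).
Qed.

Lemma sum_periodic k q f : periodic q f ->
  \sum_(0 <= t < k * q) f t = k%:R * \sum_(0 <= t < q) f t.
Proof.
move=> fq; elim: k => [|k IH]; first by rewrite mul0n big_geq // mul0r.
rewrite mulSn addnC (big_cat_nat (n := (k * q)%N)) ?leq_addr //= IH.
rewrite -{1}[(k * q)%N]add0n big_addn addKn -natr1 mulrDl mul1r.
congr (_ + _); apply: eq_bigr => t _.
by rewrite (periodic_mul k fq).
Qed.

Lemma mean_mul k q f : (0 < k)%N -> periodic q f -> mean (k * q) f = mean q f.
Proof.
move=> k0 fq; have [->|q0] := posnP q; first by rewrite muln0.
rewrite /mean sum_periodic // natrM; field.
by rewrite !pnatr_eq0 -!lt0n k0 q0.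
Qed.

Lemma mean_period q r f : (0 < q)%N -> (0 < r)%N ->
  periodic q f -> periodic r f -> mean q f = mean r f.
Proof.
by move=> q0 r0 fq fr; rewrite -(mean_mul r0 fq) mulnC (mean_mul q0 fr).
Qed.

Lemma sum_shift_coprime a b i g : coprime a b -> periodic b g ->
  \sum_(0 <= j < b) g (i + j * a)%N = \sum_(0 <= t < b) g t.
Proof.
move=> cab gb; case: b cab gb => [|b] cab gb; first by rewrite !big_geq.
rewrite !big_mkord.
have inj : injective (fun j : 'I_b.+1 => inord ((i + j * a) %% b.+1) : 'I_b.+1).
  move=> j k /(congr1 (@nat_of_ord _)) /=; rewrite !inordK ?ltn_mod // => /eqP.
  rewrite eqn_modDl => /eqP h; apply/val_inj => /=.
  have: j = k %[mod b.+1].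
    apply/eqP; move/eqP: h.
    wlog jk : j k / (k <= j)%N.
      move=> H; case/orP: (leq_total k j) => hh; first exact: H.
      by rewrite eq_sym => h2; rewrite eq_sym; apply: H.
    rewrite !eqn_mod_dvd ?leq_mul2r ?jk ?orbT // -mulnBl Gauss_dvdl //.
    by rewrite coprime_sym.
  by rewrite !modn_small.
rewrite [RHS](reindex_inj inj) /=; apply: eq_bigr => j _.
by rewrite inordK ?ltn_mod // periodic_modn.
Qed.

(** This is the Chinese remainder theorem in the form of independence: writing
    t = i + j a, the first factor depends on i alone, and for fixed i the second
    runs over a full period as j does. *)
Lemma sum_coprime a b f g : coprime a b -> periodic a f -> periodic b g ->
  \sum_(0 <= t < b * a) f t * g t
  = (\sum_(0 <= t < a) f t) * (\sum_(0 <= t < b) g t).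
Proof.
move=> cab fa gb.
have split_sum n : \sum_(0 <= t < n * a) f t * g t
    = \sum_(0 <= i < a) f i * \sum_(0 <= j < n) g (i + j * a)%N.
  elim: n => [|n IH].
    by rewrite mul0n big_geq // big1_seq // => i _; rewrite big_geq ?mulr0.
  rewrite mulSn addnC (big_cat_nat (n := (n * a)%N)) ?leq_addr //= IH.
  rewrite -{1}[(n * a)%N]add0n big_addn addKn -big_split /=.
  apply: eq_bigr => i _; rewrite (periodic_mul n fa) -mulrDr.
  by rewrite big_nat_recr //=.
rewrite split_sum mulr_suml; apply: eq_bigr => i _.
by rewrite sum_shift_coprime.
Qed.

Lemma mean_coprime a b f g : coprime a b -> periodic a f -> periodic b g ->
  mean (b * a) (fun t => f t * g t) = mean a f * mean b g.
Proof.
by move=> cab fa gb; rewrite /mean sum_coprime // natrM invfM; ring.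
Qed.

(** Only the incomplete last period contributes to the error. *)
Lemma sum_mean_error q T f B : (0 < q)%N -> periodic q f ->
  (forall t, `|f t| <= B) ->
  `|\sum_(0 <= t < T) f t - T%:R * mean q f| <= 2 * q%:R * B.
Proof.
move=> q0 fq fB; have B0 : 0 <= B by apply: le_trans (fB 0%N).
have sumB n : `|\sum_(0 <= t < n) f t| <= n%:R * B.
  apply: le_trans (ler_norm_sum _ _ _) _.
  apply: le_trans (ler_sum _ (fun t _ => fB t)) _.
  by rewrite sumr_const_nat subn0 mulr_natl.
have meanB : `|mean q f| <= B.
  rewrite normrM normfV normr_nat ler_pdivrMr ?ltr0n //.
  by rewrite mulrC sumB.
have q0' : q%:R != 0 :> K by rewrite pnatr_eq0 -lt0n.
have rq : (T %% q)%N%:R <= q%:R :> K by rewrite ler_nat ltnW // ltn_mod.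
rewrite (big_cat_nat (n := (T %/ q * q)%N)) ?leq_trunc_div //=.
rewrite sum_periodic // -{1}[(T %/ q * q)%N]add0n big_addn.
have -> : (T - T %/ q * q = T %% q)%N by rewrite {1}(divn_eq T q) addKn.
under eq_bigr do rewrite (periodic_mul _ fq).
have -> : T%:R * mean q f
    = (T %/ q)%N%:R * \sum_(0 <= t < q) f t + (T %% q)%N%:R * mean q f.
  by rewrite {1}(divn_eq T q) natrD natrM /mean; field.
rewrite opprD addrACA subrr add0r.
apply: le_trans (ler_normB _ _) _.
have -> : 2 * q%:R * B = q%:R * B + q%:R * B by ring.
rewrite normrM normr_nat lerD ?ler_pM //.
by apply: le_trans (sumB _) _; rewrite ler_wpM2r.
Qed.

End Mean.

(** * Products of independent mean-zero functions *)

Lemma coprime_prodr (J : finType) (P : pred J) (F : J -> nat) m :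
  (forall i, P i -> coprime m (F i)) -> coprime m (\prod_(i | P i) F i).
Proof.
move=> mF; elim/big_rec: _ => [|i n /mF mi mn]; first exact: coprimen1.
by rewrite coprimeMr mi.
Qed.

(** The functions [psi i] behave like independent centred random variables
    because their periods are coprime; [v i] is the variance. *)
Section Orthogonal.
Variables (K : realFieldType) (I : finType) (q : I -> nat).
Variables (psi : I -> nat -> K) (v : I -> K).
Hypothesis q_gt0 : forall i, (0 < q i)%N.
Hypothesis q_coprime : forall i j, i != j -> coprime (q i) (q j).
Hypothesis psi_periodic : forall i, periodic (q i) (psi i).
Hypothesis psi_mean0 : forall i, mean (q i) (psi i) = 0.
Hypothesis psi_var : forall i, mean (q i) (fun t => psi i t * psi i t) = v i.
Hypothesis psi_le : forall i t, `|psi i t| <= (q i)%:R.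
Implicit Types (A B : {set I}) (h : nat -> K) (f : I -> nat -> K).

Definition modulus A : nat := (\prod_(i in A) q i)%N.
Definition psis A t : K := \prod_(i in A) psi i t.

Lemma modulus_gt0 A : (0 < modulus A)%N.
Proof. exact: prodn_cond_gt0. Qed.

Lemma periodic_prod A f : (forall i, i \in A -> periodic (q i) (f i)) ->
  periodic (modulus A) (fun t => \prod_(i in A) f i t).
Proof.
move=> fq t; apply: eq_bigr => i iA.
rewrite /modulus (bigD1 i) //= mulnC.
by rewrite (periodic_mul _ (fq i iA)).
Qed.

Lemma mean_prod A f : (forall i, periodic (q i) (f i)) ->
  mean (modulus A) (fun t => \prod_(i in A) f i t)
  = \prod_(i in A) mean (q i) (f i).
Proof.
move=> fq; elim: {A}_.+1 {-2}A (ltnSn #|A|) => // n IH A sA.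
have [->|[i iA]] := set_0Vmem A.
  rewrite /modulus !big_set0 /mean big_nat1 big_set0.
  by rewrite divr1.
have sB : (#|A :\ i| < n)%N by rewrite [#|A|](cardsD1 i) iA in sA.
rewrite [RHS](big_setD1 i) //= -IH // /modulus (big_setD1 i) //=.
rewrite mulnC -mean_coprime //.
- rewrite /mean; congr (_ / _); apply: eq_bigr => t _.
  by rewrite (big_setD1 i).
- apply: coprime_prodr => j; rewrite in_setD1 => /andP[ji _].
  by rewrite q_coprime // eq_sym.
- exact: periodic_prod.
Qed.

Lemma psis_periodic A : periodic (modulus A) (psis A).
Proof. by apply: periodic_prod => i _. Qed.

Lemma psis_le A t : `|psis A t| <= (modulus A)%:R.
Proof.
rewrite normr_prod natr_prod; apply: ler_prod => i _.
by rewrite normr_ge0 psi_le.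
Qed.

Lemma psis_setU A B t : A \subset B ->
  psis A t = \prod_(i in B) (if i \in A then psi i t else 1).
Proof.
move=> AB; rewrite -big_mkcondr; apply: eq_bigl => i.
by rewrite andb_idl // => /(subsetP AB).
Qed.

(** Orthogonality: if A and B differ, some [psi i] occurs exactly once in the
    product, and its mean factors out as 0. *)
Lemma mean_psisM m h A B : (0 < m)%N -> periodic m h ->
  (forall i, i \in A :|: B -> coprime m (q i)) ->
  mean (m * (modulus A * modulus B)) (fun t => h t * (psis A t * psis B t))
  = mean m h * (if A == B then \prod_(i in A) v i else 0).
Proof.
move=> m0 hm cm; set U := A :|: B in cm *.
pose f i t := (if i \in A then psi i t else 1)
  * (if i \in B then psi i t else 1).
have fE t : psis A t * psis B t = \prod_(i in U) f i t.
  by rewrite big_split /= -!psis_setU ?subsetUl ?subsetUr.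
have fq i : periodic (q i) (f i).
  by move=> t; rewrite /f psi_periodic.
have fU : periodic (modulus U) (fun t => psis A t * psis B t).
  by move=> t; rewrite !fE; apply: (periodic_prod (f := f)) => i _.
have cmU : coprime m (modulus U) by apply: coprime_prodr.
rewrite -(@mean_period _ (modulus U * m)); last 4 first.
- by rewrite muln_gt0 modulus_gt0.
- by rewrite !muln_gt0 m0 !modulus_gt0.
- apply: periodicM; first exact: periodic_mul.
  by rewrite mulnC; apply: periodic_mul.
- apply: periodicM; first by rewrite mulnC; apply: periodic_mul.
  apply: periodic_mul; apply: periodicM; last first.
    exact/periodic_mul/psis_periodic.
  by rewrite mulnC; exact/periodic_mul/psis_periodic.
rewrite mean_coprime //; congr (_ * _).
transitivity (\prod_(i in U) mean (q i) (f i)).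
  rewrite -mean_prod // /mean; congr (_ / _).
  by apply: eq_bigr => t _; rewrite fE.
have [eqAB|neqAB] := eqVneq A B.
  rewrite /U -eqAB setUid; apply: eq_bigr => i iA.
  rewrite -psi_var /f -eqAB iA //.
have [i iAB]: exists i, (i \in A) (+) (i \in B).
  apply/existsP; apply: contraR neqAB => /existsPn nAB.
  by apply/eqP/setP => i; have := nAB i; case: (i \in A); case: (i \in B).
rewrite (bigD1 i) /=; last first.
  by rewrite in_setU; move: iAB; case: (i \in A); case: (i \in B).
suff -> : mean (q i) (f i) = 0 by rewrite mul0r.
rewrite -(psi_mean0 i) /mean; congr (_ / _); apply: eq_bigr => t _.
by move: iAB; rewrite /f; case: (i \in A); case: (i \in B);
  rewrite //= (mulr1, mul1r).
Qed.

(** Over a full period the mean of the square is diagonal. For the interval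
    [0, T) each pair A, B has its own period, bounded by the product of the two
    moduli, so the error stays polynomial in the moduli in use, although the
    period common to all pairs is exponentially larger. *)
Lemma sum_square_error (c : {set I} -> K) h m T : (0 < m)%N ->
  periodic m h -> (forall t, `|h t| <= 1) ->
  (forall A, c A != 0 -> forall i, i \in A -> coprime m (q i)) ->
  `|\sum_(0 <= t < T) (\sum_A c A * psis A t) ^+ 2 * h t
    - T%:R * mean m h * \sum_A c A ^+ 2 * \prod_(i in A) v i|
  <= 2 * m%:R * (\sum_A `|c A| * (modulus A)%:R ^+ 2) ^+ 2.
Proof.
move=> m0 hm h1 cm.
pose s A B : K := \sum_(0 <= t < T) h t * (psis A t * psis B t).
pose e A B : K :=
  mean (m * (modulus A * modulus B)) (fun t => h t * (psis A t * psis B t)).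
have -> : \sum_(0 <= t < T) (\sum_A c A * psis A t) ^+ 2 * h t
    = \sum_A \sum_B c A * c B * s A B.
  rewrite (eq_bigr (fun t => \sum_A \sum_B
    c A * c B * (h t * (psis A t * psis B t)))); last first.
    move=> t _; rewrite expr2 mulr_suml mulr_suml; apply: eq_bigr => A _.
    rewrite mulr_sumr mulr_suml; apply: eq_bigr => B _; ring.
  rewrite exchange_big; apply: eq_bigr => A _ /=.
  by rewrite exchange_big; apply: eq_bigr => B _; rewrite mulr_sumr.
have -> : T%:R * mean m h * (\sum_A c A ^+ 2 * \prod_(i in A) v i)
    = \sum_A \sum_B c A * c B * (T%:R * e A B).
  rewrite mulr_sumr; apply: eq_bigr => A _.
  have eE B : c A * c B * (T%:R * e A B) = c A * c B * (T%:R
      * (mean m h * (if A == B then \prod_(i in A) v i else 0))).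
    have [->|cA] := eqVneq (c A) 0; first by rewrite !mul0r.
    have [->|cB] := eqVneq (c B) 0; first by rewrite mulr0 !mul0r.
    rewrite /e mean_psisM // => i; rewrite in_setU => /orP[]; exact: cm.
  rewrite (eq_bigr _ (fun B _ => eE B)) (bigD1 A) //= eqxx /=.
  rewrite [X in _ + X]big1 => [|B BA]; first by ring.
  by rewrite eq_sym (negPf BA) !mulr0.
rewrite -sumrB.
apply: le_trans (ler_norm_sum _ _ _) _.
have -> : 2 * m%:R * (\sum_A `|c A| * (modulus A)%:R ^+ 2) ^+ 2
  = \sum_A \sum_B `|c A| * `|c B| *
     (2 * (m * (modulus A * modulus B))%:R * (modulus A * modulus B)%:R).
  rewrite expr2 mulr_suml mulr_sumr; apply: eq_bigr => A _.
  rewrite mulr_sumr mulr_sumr; apply: eq_bigr => B _; rewrite !natrM; ring.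
apply: ler_sum => A _; rewrite -sumrB.
apply: le_trans (ler_norm_sum _ _ _) _; apply: ler_sum => B _.
rewrite -mulrBr !normrM ler_wpM2l ?mulr_ge0 //.
apply: sum_mean_error.
- by rewrite !muln_gt0 m0 !modulus_gt0.
- apply: periodicM; first by rewrite mulnC; apply: periodic_mul.
  apply: periodic_mul; apply: periodicM; last first.
    exact/periodic_mul/psis_periodic.
  by rewrite mulnC; exact/periodic_mul/psis_periodic.
move=> t; rewrite !normrM natrM -[leRHS]mul1r.
rewrite ler_pM ?mulr_ge0 // ler_pM // psis_le //.
Qed.

End Orthogonal.

(** * Selberg weights with an additive truncation *)

Lemma bernoulli (K : realFieldType) (x : K) n : 0 <= x ->
  1 + n%:R * x <= (1 + x) ^+ n.
Proof.
move=> x0; elim: n => [|n IH]; first by rewrite mul0r addr0.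
rewrite exprS; apply: le_trans (ler_wpM2l _ IH); last by rewrite addr_ge0.
have n0 : 0 <= n%:R :> K by [].
rewrite -natr1; nra.
Qed.

Section Levels.
Variables (K : realFieldType) (I : finType) (g : I -> K) (wt : I -> nat).
Hypothesis g_gt0 : forall i, 0 < g i.
Hypothesis wt_gt0 : forall i, (0 < wt i)%N.
Implicit Types (A B : {set I}) (i : I) (k : nat).

Definition level A : nat := (\sum_(i in A) wt i)%N.
Definition gprod A : K := \prod_(i in A) g i.
Definition gsum k : K := \sum_(A | (level A <= k)%N) gprod A.

Lemma gprod_gt0 A : 0 < gprod A.
Proof. exact: prodr_gt0. Qed.

Lemma gprod_ge0 A : 0 <= gprod A.
Proof. exact/ltW/gprod_gt0. Qed.

Lemma gsum_ge0 k : 0 <= gsum k.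
Proof. by apply: sumr_ge0 => A _; rewrite ltW // gprod_gt0. Qed.

Lemma levelU1 i B : i \notin B -> level (i |: B) = (wt i + level B)%N.
Proof. by move=> iB; rewrite /level big_setU1. Qed.

Lemma gprodU1 i B : i \notin B -> gprod (i |: B) = g i * gprod B.
Proof. by move=> iB; rewrite /gprod big_setU1. Qed.

Lemma level_eq0 A : (level A == 0%N) = (A == set0).
Proof.
apply/idP/eqP => [|->]; last by rewrite /level big_set0.
rewrite /level sum_nat_eq0 => /forallP h; apply/setP => i; rewrite inE.
by apply/negP => /(implyP (h i)); rewrite eqn0Ngt wt_gt0.
Qed.

Lemma gsum0 : gsum 0 = 1.
Proof.
rewrite /gsum (eq_bigl (pred1 set0)) => [|A]; last by rewrite leqn0 level_eq0.
by rewrite big_pred1_eq /gprod big_set0.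
Qed.

Lemma gsum_ge1 k : 1 <= gsum k.
Proof.
rewrite /gsum (bigD1 set0) /=; last by rewrite /level big_set0.
rewrite /gprod big_set0 lerDl sumr_ge0 // => A _.
exact/ltW/gprod_gt0.
Qed.

Lemma sum_setU1 i (F : {set I} -> K) :
  \sum_(A : {set I} | i \in A) F A = \sum_(B : {set I} | i \notin B) F (i |: B).
Proof.
rewrite (reindex_onto (fun B : {set I} => i |: B) (fun A : {set I} =>
  A :\ i)) /=; last first.
  by move=> A iA; rewrite setD1K.
apply: eq_bigl => B; rewrite setU11 /=.
apply/eqP/idP => [<-|iB]; first by rewrite setD11.
by rewrite setU1K.
Qed.

Section Growth.
Variable kappa : nat.
Hypothesis g_level : forall j,
  \sum_(i | wt i == j) j%:R * g i <= kappa%:R.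

(** Weighting each set of level k + 1 by its level and removing one of its
    elements gives a set of lower level. The elements that can be put back all
    have the same weight j, and j times their total density is at most
    [kappa]. *)
Lemma gsum_level k :
  k.+1%:R * \sum_(A | level A == k.+1) gprod A <= kappa%:R * gsum k.
Proof.
have -> : k.+1%:R * \sum_(A | level A == k.+1) gprod A
  = \sum_i \sum_(B : {set I} | (i \notin B) && (wt i + level B == k.+1)%N)
      (wt i)%:R * g i * gprod B.
  rewrite mulr_sumr.
  rewrite (eq_bigr (fun A : {set I} => \sum_(i in A) (wt i)%:R * gprod A));
    last first.
    by move=> A /eqP <-; rewrite /level natr_sum mulr_suml.
  rewrite (exchange_big_dep predT) //=; apply: eq_bigr => i _.
  rewrite (eq_bigl (fun A : {set I} => (i \in A) && (level A == k.+1)));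
    last first.
    by move=> A; rewrite andbC.
  rewrite big_mkcondr sum_setU1 [RHS]big_mkcondr; apply: eq_bigr => B iB.
  by rewrite levelU1 // gprodU1 // mulrA.
apply: (@le_trans _ _ (\sum_i \sum_(B | (wt i + level B == k.+1)%N)
      (wt i)%:R * g i * gprod B)).
  apply: ler_sum => i _; rewrite big_mkcondl; apply: ler_sum => B _.
  case: ifP => // _; rewrite !mulr_ge0 // ltW // gprod_gt0 //.
rewrite (exchange_big_dep (fun B => (level B <= k)%N)) /=; last first.
  by move=> i B _ /eqP; have := wt_gt0 i; lia.
rewrite /gsum mulr_sumr; apply: ler_sum => B Bk.
rewrite -mulr_suml ler_wpM2r //; first exact/ltW/gprod_gt0.
apply: le_trans _ (g_level (k.+1 - level B)%N); rewrite le_eqVlt; apply/orP;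
  left.
apply/eqP; rewrite (eq_bigl (fun i => wt i == (k.+1 - level B)%N)).
  by apply: eq_bigr => i /eqP ->.
move=> i; apply/eqP/eqP; lia.
Qed.

Lemma gsumS k : gsum k.+1 * k.+1%:R ^+ kappa <= gsum k * k.+2%:R ^+ kappa.
Proof.
have k0 : 0 < k.+1%:R :> K by rewrite ltr0n.
have -> : gsum k.+1 = gsum k + \sum_(A | level A == k.+1) gprod A.
  rewrite /gsum (bigID (fun A => (level A <= k)%N)) /=; congr (_ + _).
    by apply: eq_bigl => A; lia.
  by apply: eq_bigl => A; lia.
have step : \sum_(A | level A == k.+1) gprod A
    <= gsum k * (kappa%:R * k.+1%:R^-1).
  rewrite mulrA ler_pdivlMr // mulrC (mulrC (gsum k)).
  exact: gsum_level.
have -> : k.+2%:R = (1 + k.+1%:R^-1) * k.+1%:R :> K.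
  by rewrite mulrDl mulVf ?gt_eqF // mul1r natr1.
rewrite exprMn mulrA ler_wpM2r ?exprn_ge0 //.
apply: (@le_trans _ _ (gsum k * (1 + kappa%:R * k.+1%:R^-1))).
  by rewrite mulrDr mulr1 lerD2l.
by rewrite ler_wpM2l ?gsum_ge0 // bernoulli // invr_ge0 ltW.
Qed.

(** The recursion of [gsum_level] forces at most polynomial growth. The ratio
    form gives both the doubling bound that the sieve needs and a crude bound on
    the sum itself. *)
Lemma gsum_growth a b :
  gsum (a + b) * a.+1%:R ^+ kappa <= gsum a * (a + b).+1%:R ^+ kappa.
Proof.
elim: b => [|b IH]; first by rewrite addn0.
have p0 : 0 < (a + b).+1%:R ^+ kappa :> K by rewrite exprn_gt0 // ltr0n.
rewrite -(ler_pM2r p0) addnS.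
apply: (@le_trans _ _ (gsum (a + b) * (a + b).+2%:R ^+ kappa * a.+1%:R ^+
  kappa)).
  by rewrite mulrAC ler_wpM2r ?exprn_ge0 // gsumS.
rewrite mulrAC [leRHS]mulrAC; rewrite ler_wpM2r ?exprn_ge0 //.
Qed.

Lemma gsum_double k : gsum (k + k) <= 2 ^+ kappa * gsum k.
Proof.
have p0 : 0 < k.+1%:R ^+ kappa :> K by rewrite exprn_gt0 // ltr0n.
rewrite -(ler_pM2r p0); apply: le_trans (gsum_growth k k) _.
rewrite mulrAC -exprMn mulrC ler_wpM2r ?gsum_ge0 //.
rewrite lerXn2r ?nnegrE ?mulr_ge0 // -natrM ler_nat; lia.
Qed.

Lemma gsum_poly k : gsum k <= k.+1%:R ^+ kappa.
Proof. by have := gsum_growth 0 k; rewrite gsum0 expr1n mulr1 mul1r. Qed.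

End Growth.
End Levels.

Section Weights.
Variables (K : realFieldType) (I : finType) (q wt : I -> nat) (g : I -> K).
Variables (psi : I -> nat -> K).
Hypothesis q_gt0 : forall i, (0 < q i)%N.
Hypothesis q_coprime : forall i j, i != j -> coprime (q i) (q j).
Hypothesis q_le : forall i, (q i <= 2 ^ wt i)%N.
Hypothesis g_gt0 : forall i, 0 < g i.
Hypothesis psi_periodic : forall i, periodic (q i) (psi i).
Hypothesis psi_mean0 : forall i, mean (q i) (psi i) = 0.
Hypothesis psi_var : forall i,
  mean (q i) (fun t => psi i t * psi i t) = (g i)^-1.
Hypothesis psi_le : forall i t, `|psi i t| <= (q i)%:R.
Variable D : nat.
Implicit Types (A B : {set I}) (i : I) (h : nat -> K).

Local Notation level := (level wt).
Local Notation gprod := (gprod g).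
Local Notation gsum := (gsum g wt).

(** In Selberg's diagonal variables the coefficient at A is the density of A
    times a linear cutoff in its level, which natural subtraction truncates
    at D. *)
Definition weight t : K :=
  \sum_A gprod A * (D - level A)%N%:R * psis psi A t.

Definition werror m : K := 2 * m%:R * (D%:R * 4 ^+ D * gsum D) ^+ 2.

Lemma modulus_le A : (modulus q A <= 2 ^ level A)%N.
Proof. by rewrite /modulus /level expn_sum; apply: leq_prod. Qed.

Lemma coef_error (c : {set I} -> K) :
  (forall A, `|c A| <= gprod A * D%:R) ->
  (forall A, (D <= level A)%N -> c A = 0) ->
  \sum_A `|c A| * (modulus q A)%:R ^+ 2 <= D%:R * 4 ^+ D * gsum D.
Proof.
move=> c_le c0; rewrite mulr_sumr [leRHS]big_mkcond; apply: ler_sum => A _.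
have [DA|AD] := leqP D (level A).
  rewrite c0 // normr0 mul0r; case: ifP => // _.
  by rewrite !mulr_ge0 ?exprn_ge0 // ltW // gprod_gt0.
rewrite (ltnW AD).
have -> : D%:R * 4 ^+ D * gprod A = (gprod A * D%:R) * 4 ^+ D by ring.
rewrite ler_pM ?exprn_ge0 // -!natrX ler_nat -[4%N]/(2 ^ 2)%N -expnM mulnC
  expnM.
by rewrite leq_exp2r // (leq_trans (modulus_le A)) // leq_exp2l // ltnW.
Qed.

(** Sets of level at most H = D/2 have cutoff at least H, and their diagonal
    terms already give the lower bound. *)
Lemma sum_weight_ge H T : D = (H + H)%N ->
  T%:R * H%:R ^+ 2 * gsum H - werror 1
  <= \sum_(0 <= t < T) weight t ^+ 2.
Proof.
move=> DH.
pose c A : K := gprod A * (D - level A)%N%:R.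
have c_le A : `|c A| <= gprod A * D%:R.
  rewrite ger0_norm ?mulr_ge0 ?gprod_ge0 //.
  by rewrite ler_wpM2l ?gprod_ge0 // ler_nat leq_subr.
have c0 A : (D <= level A)%N -> c A = 0.
  by rewrite -subn_eq0 /c => /eqP ->; rewrite mulr0.
have := @sum_square_error K I q psi (fun i => (g i)^-1) q_gt0 q_coprime
  psi_periodic psi_mean0 psi_var psi_le c (fun _ => 1) 1 T isT
  (fun _ => erefl) (fun _ => _) _.
rewrite normr1 lexx => /(_ (fun=> isT)) /(_ (fun _ _ _ _ => coprime1n _)).
rewrite (eq_bigr (fun t => weight t ^+ 2)) => [|t _]; last by rewrite mulr1.
have -> : mean 1 (fun _ => 1) = 1 :> K by rewrite /mean big_nat1 divr1.
rewrite mulr1 => err.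
have main : H%:R ^+ 2 * gsum H <= \sum_A c A ^+ 2 * \prod_(i in A) (g i)^-1.
  rewrite mulr_sumr [leLHS]big_mkcond; apply: ler_sum => A _.
  have gA := @gprod_gt0 _ _ _ g_gt0 A.
  have -> : c A ^+ 2 * (\prod_(i in A) (g i)^-1)
      = (D - level A)%N%:R ^+ 2 * gprod A.
    by rewrite prodfV -/(gprod A) /c; field; rewrite gt_eqF.
  case: ifP => AH; last by rewrite mulr_ge0 ?exprn_ge0 ?gprod_ge0.
  rewrite ler_wpM2r ?gprod_ge0 // lerXn2r ?nnegrE // ler_nat; lia.
have ec := coef_error c_le c0.
have e2 : 2 * 1 * (\sum_A `|c A| * (modulus q A)%:R ^+ 2) ^+ 2 <= werror 1.
  rewrite /werror ler_wpM2l ?mulr_ge0 // lerXn2r ?nnegrE //.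
    by apply: sumr_ge0 => A _; rewrite mulr_ge0 ?exprn_ge0.
  by apply: le_trans _ ec; apply: sumr_ge0 => A _; rewrite mulr_ge0 ?exprn_ge0.
have := le_trans err e2; rewrite ler_norml => /andP[lo _].
have := ler_wpM2l (ler0n K T) main; rewrite mulrA.
move: lo; lra.
Qed.

(** On the support of h the value of [psi i] is a constant, and the
    coefficients at A and at A with i added combine into the difference of two
    cutoffs, which is at most [wt i]. This is where the weight becomes small on
    multiples of a prime. *)
Lemma sum_weight_le i h m T : (0 < m)%N -> periodic m h ->
  (forall t, 0 <= h t <= 1) ->
  (forall j, j != i -> coprime m (q j)) ->
  (forall t, h t != 0 -> psi i t = - (g i)^-1) ->
  \sum_(0 <= t < T) weight t ^+ 2 * h t
  <= T%:R * mean m h * ((wt i)%:R ^+ 2 * gsum D) + werror m.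
Proof.
move=> m0 hm h01 cm hpsi.
pose c A : K := if i \in A then 0
  else gprod A * ((D - level A)%N%:R - (D - level (i |: A))%N%:R).
have dif A : i \notin A -> exists2 n, (n <= minn (wt i) (D - level A))%N
    & (D - level A)%N%:R - (D - level (i |: A))%N%:R = n%:R :> K.
  move=> iA; exists ((D - level A) - (D - level (i |: A)))%N.
    rewrite levelU1 //; lia.
  by rewrite -natrB // levelU1 //; lia.
have c_le A : `|c A| <= gprod A * D%:R.
  have gA := ltW (@gprod_gt0 _ _ _ g_gt0 A).
  rewrite /c; case: ifPn => iA; first by rewrite normr0 mulr_ge0.
  have [n ln ->] := dif A iA.
  rewrite ger0_norm ?mulr_ge0 // ler_wpM2l // ler_nat; lia.
have c0 A : (D <= level A)%N -> c A = 0.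
  move=> DA; rewrite /c; case: ifPn => // iA.
  have [n ln ->] := dif A iA; have -> : n = 0%N by lia.
  by rewrite mulr0.
have cw t : weight t ^+ 2 * h t = (\sum_A c A * psis psi A t) ^+ 2 * h t.
  have [->|ht] := eqVneq (h t) 0; first by rewrite !mulr0.
  congr (_ ^+ 2 * _); rewrite /weight (bigID (fun A : {set I} => i \in A)) /=.
  rewrite sum_setU1 -big_split /=.
  rewrite [RHS](bigID (fun A : {set I} => i \in A)) /=.
  rewrite [X in _ = X + _]big1 ?add0r => [|A iA]; last first.
    by rewrite /c iA mul0r.
  apply: eq_bigr => A iA; rewrite /c (negPf iA) gprodU1 //.
  rewrite {1}/psis big_setU1 //= -/(psis psi A t) (hpsi t ht).
  by field; rewrite gt_eqF.
have h1 t : `|h t| <= 1.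
  by have /andP[h0 h1] := h01 t; rewrite ger0_norm.
have cop A : c A != 0 -> forall j, j \in A -> coprime m (q j).
  rewrite /c; case: ifPn => [|iA _ j jA]; first by rewrite eqxx.
  by apply: cm; apply: contraNneq iA => <-.
have := sum_square_error q_gt0 q_coprime
  psi_periodic psi_mean0 psi_var psi_le T m0 hm h1 cop.
rewrite -(eq_bigr _ (fun t _ => cw t)) => err.
have main : \sum_A c A ^+ 2 * \prod_(i in A) (g i)^-1
    <= (wt i)%:R ^+ 2 * gsum D.
  rewrite mulr_sumr [leRHS]big_mkcond; apply: ler_sum => A _.
  have gA := @gprod_gt0 _ _ _ g_gt0 A.
  have [DA|AD] := leqP D (level A).
    rewrite c0 // expr0n mul0r; case: ifP => // _.
    by rewrite mulr_ge0 ?exprn_ge0 // ltW.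
  rewrite (ltnW AD) /c; case: ifPn => iA.
    by rewrite expr0n mul0r mulr_ge0 ?exprn_ge0 // ltW.
  have [n ln ->] := dif A iA.
  have -> : (gprod A * n%:R) ^+ 2 * (\prod_(i in A) (g i)^-1)
      = n%:R ^+ 2 * gprod A.
    by rewrite prodfV -/(gprod A); field; rewrite gt_eqF.
  rewrite ler_wpM2r ?gprod_ge0 // lerXn2r ?nnegrE // ler_nat; lia.
have ec := coef_error c_le c0.
have e2 : 2 * m%:R * (\sum_A `|c A| * (modulus q A)%:R ^+ 2) ^+ 2 <= werror m.
  rewrite /werror ler_wpM2l ?mulr_ge0 // lerXn2r ?nnegrE //.
    by apply: sumr_ge0 => A _; rewrite mulr_ge0 ?exprn_ge0.
  by apply: le_trans _ ec; apply: sumr_ge0 => A _; rewrite mulr_ge0 ?exprn_ge0.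
have := le_trans err e2; rewrite ler_norml => /andP[_ hi].
have Tm : 0 <= T%:R * mean m h.
  rewrite mulr_ge0 // /mean divr_ge0 // sumr_ge0 // => t _.
  by case/andP: (h01 t).
have := ler_wpM2l Tm main.
move: hi; lra.
Qed.

End Weights.

(** * Primes in dyadic windows *)

Lemma prod_coprime_dvdn (I : finType) (q : I -> nat) (S : {set I}) m :
  (forall i j, i != j -> coprime (q i) (q j)) ->
  (forall i, i \in S -> q i %| m)%N -> (\prod_(i in S) q i %| m)%N.
Proof.
move=> cq; elim: {S}_.+1 {-2}S (ltnSn #|S|) => // n IH S sS qS.
have [->|[i iS]] := set_0Vmem S; first by rewrite big_set0.
rewrite (big_setD1 i) //= Gauss_dvd ?qS //=; last first.
  apply: coprime_prodr => j; rewrite in_setD1 => /andP[ji _].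
  by rewrite cq // eq_sym.
apply: IH => [|j]; last by rewrite in_setD1 => /andP[_ /qS].
by rewrite [#|S|](cardsD1 i) iS in sS.
Qed.

Lemma central_bin_le n : ('C(2 * n, n) <= 4 ^ n)%N.
Proof.
have -> : (4 ^ n = (1 + 1) ^ (2 * n))%N by rewrite expnM.
rewrite expnDn.
have ln : (n < (2 * n).+1)%N by lia.
rewrite (bigD1 (Ordinal ln)) //= !exp1n !muln1; exact: leq_addr.
Qed.

Lemma prime_ndvd_fact p n : prime p -> (n < p)%N -> ~~ (p %| n`!)%N.
Proof.
move=> pr; elim: n => [|n IH] np;
  first by rewrite fact0 dvdn1 gtn_eqF ?prime_gt1.
by rewrite factS Euclid_dvdM // negb_or IH ?(ltnW np) // gtnNdvd.
Qed.

(** Every prime in the window (n, 2n] divides the central binomial coefficient,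
    which is at most 4^n. *)
Lemma prod_primes_le (I : finType) (q : I -> nat) (S : {set I}) n :
  (forall i j, i != j -> coprime (q i) (q j)) ->
  (forall i, i \in S -> prime (q i) /\ (n < q i <= 2 * n)%N) ->
  (n ^ #|S| <= 4 ^ n)%N.
Proof.
move=> cq qS; apply: leq_trans (central_bin_le n).
apply: (@leq_trans (\prod_(i in S) q i)).
  by rewrite -prod_nat_const; apply: leq_prod => i /qS[_ /andP[/ltnW]].
apply: dvdn_leq; first by rewrite bin_gt0; lia.
apply: prod_coprime_dvdn => // i /qS[pr /andP[nq q2n]].
have : (q i %| (2 * n)`!)%N by rewrite dvdn_fact ?q2n ?prime_gt0.
rewrite -(@bin_fact (2 * n) n); last by lia.
have -> : (2 * n - n = n)%N by lia.
by rewrite !Euclid_dvdM // (negPf (prime_ndvd_fact pr nq)) !orbF.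
Qed.

Section PrimeWindows.
Variables (K : realFieldType) (I : finType) (q : I -> nat).
Hypothesis q_prime : forall i, prime (q i).
Hypothesis q_coprime : forall i j, i != j -> coprime (q i) (q j).
Hypothesis q_ge7 : forall i, (7 <= q i)%N.

Definition plevel i := up_log 2 (q i).

(** The two forms have two roots modulo p, of density 2/p; this is the
    odds 2/(p - 2) of hitting one of them. *)
Definition pdens i : K := 2 / ((q i)%:R - 2).

Lemma plevel_gt i : (2 ^ (plevel i).-1 < q i)%N.
Proof. by rewrite up_log_gtn // (leq_trans _ (q_ge7 i)). Qed.

Lemma plevel_le i : (q i <= 2 ^ plevel i)%N.
Proof. exact: up_logP. Qed.

Lemma plevel_ge3 i : (3 <= plevel i)%N.
Proof.
rewrite leqNgt; apply/negP => l2.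
have: (2 ^ plevel i <= 2 ^ 2)%N by rewrite leq_exp2l.
have := plevel_le i; have := q_ge7 i; lia.
Qed.

Lemma pdens_gt0 i : 0 < pdens i.
Proof.
rewrite /pdens divr_gt0 // subr_gt0 ltr_nat.
by apply: leq_trans (q_ge7 i).
Qed.

Lemma pdens_le i : 2 / (q i)%:R <= pdens i <= 4 / (q i)%:R.
Proof.
have q7 : 7 <= (q i)%:R :> K by rewrite ler_nat.
rewrite /pdens; apply/andP; split.
  rewrite ler_pdivrMr; last by lra.
  rewrite mulrAC ler_pdivlMr; last by lra.
  by lra.
rewrite ler_pdivrMr; last by lra.
by rewrite mulrAC ler_pdivlMr; lra.
Qed.

(** By [prod_primes_le] there are at most 2^j / (j - 1) primes of level j, each
    of density at most 4 / 2^(j - 1). *)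
Lemma sum_window j : \sum_(i | plevel i == j) j%:R * pdens i <= 16.
Proof.
pose S := [set i | plevel i == j].
have [S0|[i0]] := set_0Vmem S.
  rewrite big1 // => i ij.
  have iS : i \in S by rewrite inE.
  by rewrite S0 inE in iS.
rewrite inE => /eqP ij; have j3 := plevel_ge3 i0; rewrite ij in j3.
have cheb : ((2 ^ j.-1) ^ #|S| <= 4 ^ (2 ^ j.-1))%N.
  apply: (prod_primes_le q_coprime) => i; rewrite inE => /eqP iij.
  split=> //; have := plevel_gt i; rewrite iij => ->.
  by rewrite -expnS prednK ?(leq_trans _ j3) // -iij plevel_le.
have card : (j.-1 * #|S| <= 2 ^ j)%N.
  move: cheb; rewrite -expnM -[4%N]/(2 ^ 2)%N -expnM -expnS prednK; last by lia.
  by rewrite leq_exp2l.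
have densj i : plevel i == j -> pdens i <= 4 / (2 ^ j.-1)%N%:R.
  move=> /eqP iij; have /andP[_ h] := pdens_le i; apply: le_trans h _.
  rewrite ler_wpM2l // lef_pV2 ?posrE ?ltr0n ?expn_gt0 //; last first.
    by rewrite prime_gt0.
  by rewrite ler_nat -iij ltnW // plevel_gt.
apply: (@le_trans _ _ (\sum_(i in S) j%:R * (4 / (2 ^ j.-1)%N%:R))).
  rewrite [leRHS](eq_bigl (fun i => plevel i == j)) => [|i];
    last by rewrite /S inE.
  by apply: ler_sum => i iij; rewrite ler_wpM2l // densj.
rewrite sumr_const -[_ *+ #|S|]mulr_natr.
have p0 : 0 < (2 ^ j.-1)%N%:R :> K by rewrite ltr0n expn_gt0.
rewrite -[leLHS]mulrA [4 / _ * _]mulrAC mulrA ler_pdivrMr // mulrA.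
have -> : j%:R * 4 * #|S|%:R = (j * 4 * #|S|)%N%:R :> K by rewrite !natrM.
rewrite -natrM ler_nat.
have e : (2 ^ j = 2 * 2 ^ j.-1)%N by rewrite -expnS prednK //; lia.
rewrite e in card; nia.
Qed.

Lemma sum_plevel D : (forall i, (plevel i <= D)%N) ->
  \sum_i (plevel i)%:R * pdens i <= 16 * D.+1%:R.
Proof.
move=> lD; pose f i : 'I_D.+1 := inord (plevel i).
rewrite (partition_big f predT) //=.
apply: (@le_trans _ _ (\sum_(j < D.+1) 16)); last first.
  by rewrite sumr_const card_ord mulr_natr.
apply: ler_sum => j _; apply: le_trans _ (sum_window j).
rewrite le_eqVlt; apply/orP; left; apply/eqP.
rewrite (eq_bigl (fun i => plevel i == j)); last first.
  move=> i; rewrite -val_eqE /= inordK // ltnS; exact: lD.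
by apply: eq_bigr => i /eqP ->.
Qed.

Lemma sum_plevel_sq D : (forall i, (plevel i <= D)%N) -> (0 < D)%N ->
  \sum_i (2 / (q i)%:R + D%:R * (2 / (q i)%:R ^+ 2)) * (plevel i)%:R ^+ 2
  <= 64 * D%:R ^+ 2 :> K.
Proof.
move=> lD D0.
apply: (@le_trans _ _ (\sum_i 2 * D%:R * ((plevel i)%:R * pdens i))).
  apply: ler_sum => i _; have /andP[h _] := pdens_le i.
  have q0 : 0 < (q i)%:R :> K by rewrite ltr0n prime_gt0.
  have lq : (plevel i)%:R <= (q i)%:R :> K.
    rewrite ler_nat; apply: (leq_trans _ (plevel_gt i)).
    by have := ltn_expl (plevel i).-1 (isT : 1 < 2)%N; have := plevel_ge3 i;
      lia.
  have lDi : (plevel i)%:R <= D%:R :> K by rewrite ler_nat.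
  have l0 : 0 <= (plevel i)%:R :> K by [].
  have d0 := pdens_gt0 i.
  have e : 2 / (q i)%:R ^+ 2 * (plevel i)%:R <= pdens i.
    apply: le_trans h; rewrite expr2 invfM mulrA -mulrA.
    rewrite -[leRHS]mulr1 ler_wpM2l ?divr_ge0 // mulrC ler_pdivrMr //.
    by rewrite mul1r.
  have e1 : 2 / (q i)%:R * (plevel i)%:R ^+ 2 <= D%:R * ((plevel i)%:R * pdens
    i).
    have -> : 2 / (q i)%:R * (plevel i)%:R ^+ 2
      = (plevel i)%:R * ((plevel i)%:R * (2 / (q i)%:R)) :> K by ring.
    have q2 : 0 <= 2 / (q i)%:R :> K by rewrite divr_ge0.
    by apply: ler_pM; first [done | exact: mulr_ge0 | exact: ler_wpM2l].
  have e2 : D%:R * (2 / (q i)%:R ^+ 2) * (plevel i)%:R ^+ 2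
      <= D%:R * ((plevel i)%:R * pdens i).
    have -> : D%:R * (2 / (q i)%:R ^+ 2) * (plevel i)%:R ^+ 2
      = D%:R * ((plevel i)%:R * (2 / (q i)%:R ^+ 2 * (plevel i)%:R)) :> K by
        ring.
    by rewrite !ler_wpM2l.
  by rewrite mulrDl; lra.
rewrite -mulr_sumr; apply: le_trans (ler_wpM2l _ (sum_plevel lD)) _.
  by rewrite mulr_ge0.
rewrite -natr1; have : 1 <= D%:R :> K by rewrite ler1n.
nra.
Qed.

End PrimeWindows.

(** * The sieve for two linear forms *)

Section LinearRoots.
Variable K : realFieldType.

Lemma mean_affine q (f : nat -> K) x y : (0 < q)%N ->
  mean q (fun t => x + y * f t) = x + y * mean q f.
Proof.
move=> q0; rewrite /mean big_split /= sumr_const_nat subn0 -mulr_sumr.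
by rewrite -mulr_natr; field; rewrite pnatr_eq0 -lt0n.
Qed.

(** A linear form has exactly one root modulo m when its leading coefficient is
    a unit; Bezout coefficients give that root. *)
Lemma sum_dvd_linear (m : nat) (a b : int) : (0 < m)%N -> coprimez m a ->
  \sum_(0 <= t < m) (m%:Z %| a * t%:Z + b)%Z%:R = 1 :> K.
Proof.
move=> m0 /eqP cma; have [w' [w]] := Bezoutz m a; rewrite cma => bez.
pose t0 := `|((- b * w) %% m)%Z|%N.
have t0E : t0%:Z = ((- b * w) %% m)%Z by rewrite /t0 gez0_abs // modz_ge0 //;
  lia.
have lt0 : (t0 < m)%N by rewrite -ltz_nat t0E ltz_pmod.
rewrite big_mkord (bigD1 (Ordinal lt0)) //= big1 ?addr0 => [|t tt0].
  suff -> : (m%:Z %| a * t0%:Z + b)%Z by [].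
  rewrite t0E; have e := divz_eq (- b * w) m.
  apply/dvdzP; exists (w' * b - a * ((- b * w) %/ m)%Z).
  set Q := (_ %/ _)%Z in e *; set M := (_ %% _)%Z in e *.
  have -> : M = - b * w - Q * m by rewrite e; ring.
  transitivity (b * 1 - a * (b * w) - a * Q * m); first by ring.
  by rewrite -bez; ring.
apply/eqP; rewrite pnatr_eq0 eqb0; apply: contra tt0 => dv.
rewrite -val_eqE /= -eqz_nat t0E.
rewrite -[X in X == _](@modz_small _ m) ?ltz_nat ?ltn_ord //.
apply/eqP; apply/eqP; rewrite eqz_mod_dvd.
have -> : t%:Z - - b * w = w * (a * t%:Z + b) + w' * t%:Z * m.
  transitivity (t%:Z * 1 + b * w); first by ring.
  by rewrite -bez; ring.
by rewrite rpredD ?dvdz_mull.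
Qed.

End LinearRoots.

Section Forms.
Variables (K : realFieldType) (a b c d : int) (B : nat).
Hypothesis good : forall p, prime p -> ~~ (p %| B)%N ->
  [/\ (7 <= p)%N, ~~ (p%:Z %| a)%Z, ~~ (p%:Z %| c)%Z
    & ~~ (p%:Z %| a * d - b * c)%Z].

Definition xform (t : nat) : int := a * t%:Z + b.
Definition yform (t : nat) : int := c * t%:Z + d.
Definition hit (m t : nat) : bool := (m%:Z %| xform t)%Z || (m%:Z %| yform t)%Z.
Definition hitr (m t : nat) : K := (hit m t)%:R.

(** The determinant is a combination of the two values. *)
Lemma not_both p t : prime p -> ~~ (p %| B)%N ->
  ~~ ((p%:Z %| xform t)%Z && (p%:Z %| yform t)%Z).
Proof.
move=> pr pB; have [_ _ _] := good pr pB; apply: contra => /andP[px py].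
have -> : a * d - b * c = a * yform t - c * xform t.
  by rewrite /xform /yform; ring.
by rewrite rpredB ?dvdz_mull.
Qed.

Lemma hit_split p e t : prime p -> ~~ (p %| B)%N ->
  hitr (p ^ e.+1) t = ((p ^ e.+1)%N%:Z %| xform t)%Z%:R
    + ((p ^ e.+1)%N%:Z %| yform t)%Z%:R.
Proof.
move=> pr pB; have nb := not_both t pr pB; rewrite /hitr /hit.
have pe z : ((p ^ e.+1)%N%:Z %| z)%Z -> (p%:Z %| z)%Z.
  by apply: dvdz_trans; rewrite dvdzE /= dvdn_exp.
case hx : (_ %| xform t)%Z; case hy : (_ %| yform t)%Z;
  rewrite ?addr0 ?add0r //.
by rewrite (pe _ hx) (pe _ hy) in nb.
Qed.

Lemma hitr_periodic m : periodic m (hitr m).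
Proof.
have lin (e f : int) t :
    (m%:Z %| e * (t + m)%N%:Z + f)%Z = (m%:Z %| e * t%:Z + f)%Z.
  have -> : e * (t + m)%N%:Z + f = (e * t%:Z + f) + e * m%:Z.
    by rewrite PoszD; ring.
  by rewrite rpredDr // dvdz_mull.
by move=> t; rewrite /hitr /hit /xform /yform !lin.
Qed.

Lemma mean_hitr p e : prime p -> ~~ (p %| B)%N ->
  mean (p ^ e.+1) (hitr (p ^ e.+1)) = 2 / (p ^ e.+1)%N%:R.
Proof.
move=> pr pB; have [_ pa pc _] := good pr pB.
have pe0 : (0 < p ^ e.+1)%N by rewrite expn_gt0 prime_gt0.
have cop z : ~~ (p%:Z %| z)%Z -> coprimez (p ^ e.+1)%N%:Z z.
  by move=> pz; rewrite coprimezE /= coprimeXl // prime_coprime.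
rewrite /mean (eq_bigr _ (fun t _ => hit_split e t pr pB)) big_split /=.
by rewrite !sum_dvd_linear ?cop.
Qed.

End Forms.

(** [B] collects the primes at which the forms are not in general position;
    the sieve runs over the remaining primes up to 2^D. *)
Section Sieve.
Variables (K : realFieldType) (a b c d : int) (B D : nat).
Hypothesis good : forall p, prime p -> ~~ (p %| B)%N ->
  [/\ (7 <= p)%N, ~~ (p%:Z %| a)%Z, ~~ (p%:Z %| c)%Z
    & ~~ (p%:Z %| a * d - b * c)%Z].

Local Notation sieving_prime :=
  {p : 'I_(2 ^ D).+1 | prime p && ~~ (p %| B)%N}.

Definition sp (i : sieving_prime) : nat := val (val i).

Lemma sp_prime i : prime (sp i).
Proof. by have /andP[] := valP i. Qed.

Lemma sp_ndvd i : ~~ (sp i %| B)%N.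
Proof. by have /andP[] := valP i. Qed.

Lemma sp_inj : injective sp.
Proof. by move=> i j /val_inj/val_inj. Qed.

Lemma sp_coprime i j : i != j -> coprime (sp i) (sp j).
Proof.
by move=> ij; rewrite prime_coprime ?dvdn_prime2 ?sp_prime ?(inj_eq sp_inj).
Qed.

Lemma sp_ge7 i : (7 <= sp i)%N.
Proof. by have [] := good (sp_prime i) (sp_ndvd i). Qed.

Lemma sp_le i : (sp i <= 2 ^ D)%N.
Proof. by rewrite -ltnS ltn_ord. Qed.

Lemma plevel_sp_le i : (plevel sp i <= D)%N.
Proof. by rewrite up_log_min // sp_le. Qed.

Local Notation Z := (hitr K a b c d).

(** The indicator of a hit at p, centred and scaled to be 1 off the hits. *)
Definition sieve_psi i t : K := 1 + (- (sp i)%:R / 2) * Z (sp i) t.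

Lemma hitr01 m t : 0 <= Z m t <= 1.
Proof. by rewrite /hitr; case: hit; rewrite lexx ler01. Qed.

Lemma mean_hitr1 i : mean (sp i) (Z (sp i)) = 2 / (sp i)%:R.
Proof. by have := mean_hitr K good 0 (sp_prime i) (sp_ndvd i);
  rewrite expn1. Qed.

Lemma mean_hitr2 i : mean (sp i ^ 2) (Z (sp i ^ 2)) = 2 / (sp i)%:R ^+ 2.
Proof. by rewrite (mean_hitr K good 1 (sp_prime i) (sp_ndvd i)) natrX. Qed.

Lemma spr_ge7 i : 7 <= (sp i)%:R :> K.
Proof. by rewrite ler_nat sp_ge7. Qed.

Lemma sp_gt0 i : (0 < sp i)%N.
Proof. by rewrite prime_gt0 // sp_prime. Qed.

Lemma sieve_psi_periodic i : periodic (sp i) (sieve_psi i).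
Proof. by move=> t; rewrite /sieve_psi hitr_periodic. Qed.

Lemma sieve_psi_mean i : mean (sp i) (sieve_psi i) = 0.
Proof.
rewrite mean_affine ?sp_gt0 // mean_hitr1.
by field; have := spr_ge7 i; move=> ?; apply/eqP; lra.
Qed.

Lemma sieve_psi_var i :
  mean (sp i) (fun t => sieve_psi i t * sieve_psi i t) = (pdens K sp i)^-1.
Proof.
have q7 := spr_ge7 i.
transitivity (mean (sp i) (fun t =>
    1 + ((sp i)%:R ^+ 2 / 4 - (sp i)%:R) * Z (sp i) t)).
  rewrite /mean; congr (_ / _); apply: eq_bigr => t _.
  by rewrite /sieve_psi /hitr; case: hit => /=; field.
rewrite mean_affine ?sp_gt0 // mean_hitr1 /pdens.
by field; apply/andP; split; apply/eqP; lra.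
Qed.

Lemma sieve_psi_le i t : `|sieve_psi i t| <= (sp i)%:R.
Proof.
have q7 := spr_ge7 i; rewrite /sieve_psi /hitr ler_norml.
by case: hit => /=; apply/andP; split; lra.
Qed.

Lemma sieve_psi_hit i m t : (sp i %| m)%N -> Z m t != 0 ->
  sieve_psi i t = - (pdens K sp i)^-1.
Proof.
move=> im; have q7 := spr_ge7 i; rewrite /sieve_psi /hitr pnatr_eq0 eqb0 negbK.
move=> hm; have -> : hit a b c d (sp i) t.
  case/orP: hm => h; apply/orP; [left|right];
    by apply: dvdz_trans h; rewrite dvdzE.
by rewrite /pdens mulr1; field; apply/eqP; lra.
Qed.

Local Notation G := (gsum (pdens K sp) (plevel sp)).
Local Notation w := (weight (plevel sp) (pdens K sp) sieve_psi D).

(** The factor D on the squares makes a penalty below D exclude them all. Their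
    total contribution is still of the same order as that of the primes. *)
Definition penalty t : K :=
  \sum_i (Z (sp i) t + D%:R * Z (sp i ^ 2) t).

Let pdens_gt0 := pdens_gt0 K sp_ge7.
Let plevel_gt0 i : (0 < plevel sp i)%N :=
  leq_trans (isT : 1 <= 3)%N (plevel_ge3 sp_ge7 i).
Let sp_le_plevel := plevel_le sp.

Lemma sum_weight_penalty T : (0 < D)%N ->
  \sum_(0 <= t < T) w t ^+ 2 * penalty t
  <= T%:R * (64 * D%:R ^+ 2) * G D
     + ((2 ^ D).+1 * D.+1)%N%:R * werror (plevel sp) (pdens K sp) D (4 ^ D)%N.
Proof.
move=> D0; have G0 : 0 <= G D := gsum_ge0 (plevel sp) pdens_gt0 D.
pose err m := werror (plevel sp) (pdens K sp) D m.
have err_mono m n : (m <= n)%N -> err m <= err n.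
  move=> mn; rewrite /err /werror ler_wpM2r ?exprn_even_ge0 //.
  by rewrite ler_wpM2l // ler_nat.
have err0 n : 0 <= err n by rewrite /err /werror mulr_ge0 ?exprn_even_ge0
  ?mulr_ge0.
have bound1 i : \sum_(0 <= t < T) w t ^+ 2 * Z (sp i) t
    <= T%:R * (2 / (sp i)%:R) * ((plevel sp i)%:R ^+ 2 * G D) + err (4 ^ D)%N.
  apply: le_trans (sum_weight_le sp_gt0 sp_coprime sp_le_plevel pdens_gt0
    sieve_psi_periodic sieve_psi_mean sieve_psi_var sieve_psi_le D T
    (i := i) (sp_gt0 i) (@hitr_periodic K a b c d (sp i)) (hitr01 _) _ _) _.
  - by move=> j ji; rewrite sp_coprime // eq_sym.
  - by move=> t; apply: sieve_psi_hit.
  rewrite mean_hitr1 lerD2l err_mono // (leq_trans (sp_le i)) //.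
  by rewrite leq_exp2r.
have bound2 i : \sum_(0 <= t < T) w t ^+ 2 * Z (sp i ^ 2) t
    <= T%:R * (2 / (sp i)%:R ^+ 2) * ((plevel sp i)%:R ^+ 2 * G D) + err (4 ^
      D)%N.
  have q2 : (0 < sp i ^ 2)%N by rewrite expn_gt0 sp_gt0.
  apply: le_trans (sum_weight_le sp_gt0 sp_coprime sp_le_plevel pdens_gt0
    sieve_psi_periodic sieve_psi_mean sieve_psi_var sieve_psi_le D T
    (i := i) q2 (@hitr_periodic K a b c d (sp i ^ 2)) (hitr01 _) _ _) _.
  - by move=> j ji; rewrite coprimeXl // sp_coprime // eq_sym.
  - by move=> t; apply: sieve_psi_hit; rewrite dvdn_exp.
  rewrite mean_hitr2 lerD2l err_mono //.
  by rewrite -[4%N]/(2 ^ 2)%N -expnM mulnC expnM leq_exp2r // sp_le.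
pose q i : K := (sp i)%:R.
have -> : \sum_(0 <= t < T) w t ^+ 2 * penalty t
  = \sum_i (\sum_(0 <= t < T) w t ^+ 2 * Z (sp i) t
     + D%:R * \sum_(0 <= t < T) w t ^+ 2 * Z (sp i ^ 2) t).
  rewrite (eq_bigr (fun t => \sum_i (w t ^+ 2 * Z (sp i) t
      + D%:R * (w t ^+ 2 * Z (sp i ^ 2) t)))); last first.
    move=> t _; rewrite /penalty mulr_sumr; apply: eq_bigr => i _; ring.
  rewrite exchange_big; apply: eq_bigr => i _ /=.
  by rewrite big_split mulr_sumr.
apply: (@le_trans _ _ (\sum_i (T%:R * G D *
    ((2 / q i + D%:R * (2 / q i ^+ 2)) * (plevel sp i)%:R ^+ 2)
    + D.+1%:R * err (4 ^ D)%N))).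
  apply: ler_sum => i _.
  apply: le_trans (lerD (bound1 i) (ler_wpM2l (ler0n K D) (bound2 i))) _.
  by rewrite -natr1 le_eqVlt; apply/orP; left; apply/eqP; rewrite /q; ring.
rewrite big_split /= -mulr_sumr lerD //.
  rewrite [leRHS]mulrAC; have :=
    sum_plevel_sq K sp_prime sp_coprime sp_ge7 plevel_sp_le D0.
  by move=> h; rewrite ler_wpM2l // mulr_ge0.
rewrite sumr_const -[_ *+ #|_|]mulr_natl natrM -[leRHS]mulrA.
apply: ler_wpM2r; first exact: mulr_ge0 (ler0n K _) (err0 _).
rewrite ler_nat.
apply: leq_trans (leq_card _ (val_inj)) _; by rewrite card_ord.
Qed.

Lemma sp_surj p : prime p -> ~~ (p %| B)%N -> (p <= 2 ^ D)%N ->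
  exists i, sp i = p.
Proof.
move=> pr pB; rewrite -ltnS => pD.
have pI : prime (Ordinal pD) && ~~ (Ordinal pD %| B)%N by rewrite pr.
by exists (exist _ (Ordinal pD) pI).
Qed.

Lemma penalty_term_ge0 i t : 0 <= Z (sp i) t + D%:R * Z (sp i ^ 2) t.
Proof. by rewrite addr_ge0 ?mulr_ge0. Qed.

Lemma penalty_square i t : hit a b c d (sp i ^ 2) t -> D%:R <= penalty t.
Proof.
move=> hit2; rewrite /penalty (bigD1 i) //=.
rewrite -[leLHS]addr0 lerD ?sumr_ge0 // => [|j _]; last exact: penalty_term_ge0.
by rewrite {2}/hitr hit2 mulr1 lerDr.
Qed.

Lemma penalty_card t : #|[set i | hit a b c d (sp i) t]|%:R <= penalty t.
Proof.
rewrite /penalty -sum1_card natr_sum big_mkcond /=; apply: ler_sum => i _.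
rewrite inE; have := penalty_term_ge0 i t; rewrite {1 3}/hitr.
by case: hit => // _; rewrite lerDl mulr_ge0.
Qed.

Lemma werror_le m : werror (plevel sp) (pdens K sp) D m
  <= 2 * m%:R * ((2 ^+ D) ^+ 19) ^+ 2.
Proof.
have DS : D.+1%:R <= 2 ^+ D :> K by rewrite -natrX ler_nat ltn_expl.
have D1 : D%:R <= 2 ^+ D :> K by apply: le_trans DS; rewrite ler_nat.
have G0 : 0 <= G D := gsum_ge0 (plevel sp) pdens_gt0 D.
have GD : G D <= (2 ^+ D) ^+ 16.
  apply: le_trans (gsum_poly pdens_gt0 plevel_gt0 (sum_window K sp_prime
    sp_coprime sp_ge7) D) _.
  by rewrite lerXn2r ?nnegrE ?exprn_ge0.
have x0 : 0 <= 2 ^+ D :> K by rewrite exprn_ge0.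
rewrite /werror ler_wpM2l ?mulr_ge0 // lerXn2r ?nnegrE ?mulr_ge0 ?exprn_ge0 //.
have -> : (2 ^+ D) ^+ 19 = (2 ^+ D * (2 ^+ D) ^+ 2) * (2 ^+ D) ^+ 16 :> K.
  by rewrite -exprS -exprD.
have -> : 4 ^+ D = (2 ^+ D) ^+ 2 :> K by rewrite exprAC; congr (_ ^+ _); ring.
by rewrite ler_pM ?mulr_ge0 ?exprn_ge0 // ler_wpM2r ?exprn_ge0.
Qed.

(** If the penalty were at least C throughout, its weighted sum would be at
    least C times the total weight. The upper bound for the former and the
    lower bound for the latter have main terms in ratio 64 * 4 * 2^16 = 2^24,
    where 4 comes from D = 2H and 2^16 from [gsum_double]. With x = 2^D the
    errors are below x^43, which is negligible against the length x^50 of the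
    interval. *)
Lemma exists_small_penalty H C : D = (H + H)%N -> (25 <= D)%N ->
  (2 ^ 24 < C)%N ->
  exists2 t, (t < 2 ^ (50 * D))%N & penalty t < C%:R.
Proof.
move=> DH D25 C24; set T := (2 ^ (50 * D))%N.
have [/existsP[t pt]|] := boolP [exists t : 'I_T, penalty t < C%:R].
  by exists t.
rewrite negb_exists => /forallP all_big; exfalso.
set x : K := 2 ^+ D.
have x32 : 2 ^+ 25 <= x.
  by rewrite /x -!natrX ler_nat leq_exp2l.
have DS : D.+1%:R <= x by rewrite /x -natrX ler_nat ltn_expl.
have H1 : 1 <= H%:R :> K by rewrite ler1n; lia.
have D0 : (0 < D)%N by lia.
have Tx : T%:R = x ^+ 50 by rewrite /T natrX mulnC exprM.
have G1 : 1 <= G H := gsum_ge1 (plevel sp) pdens_gt0 H.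
have GD : G D <= 2 ^+ 16 * G H.
  have := gsum_double pdens_gt0 plevel_gt0
    (sum_window K sp_prime sp_coprime sp_ge7) H.
  by rewrite -DH.
have lo := sum_weight_ge sp_gt0 sp_coprime sp_le_plevel pdens_gt0
    sieve_psi_periodic sieve_psi_mean sieve_psi_var sieve_psi_le T DH.
have up := @sum_weight_penalty T D0.
have e1 := werror_le 1; have e4 := werror_le (4 ^ D).
set S := \sum_(0 <= t < T) w t ^+ 2 in lo.
have SP : (2 ^+ 24 + 1) * S <= \sum_(0 <= t < T) w t ^+ 2 * penalty t.
  apply: (@le_trans _ _ (C%:R * S)).
    rewrite ler_wpM2r //; first by apply: sumr_ge0 => t _;
      rewrite exprn_even_ge0.
    by rewrite -natrX natr1 ler_nat.
  rewrite /S mulr_sumr !big_mkord; apply: ler_sum => t _.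
  by rewrite mulrC ler_wpM2l ?exprn_even_ge0 // leNgt all_big.
have x4 : (4 ^ D)%N%:R = x ^+ 2.
  by rewrite natrX /x exprAC; congr (_ ^+ _); ring.
have x1 : 1 <= x by apply: le_trans x32; rewrite exprn_ege1 // (ler_nat K 1 2).
have n2 : ((2 ^ D).+1 * D.+1)%N%:R <= 2 * x * x.
  rewrite natrM ler_pM // -natr1 natrX -/x; lra.
have xx : 2 ^+ 24 + 1 <= x.
  by apply: le_trans x32; rewrite [leRHS]exprS mulr2n mulrDl !mul1r lerD2l
    exprn_ege1 // (ler_nat K 1 2).
rewrite x4 mulr1n -/x in e4 e1.
set c24 : K := 2 ^+ 24 in SP xx.
have c0 : 0 <= c24 by rewrite exprn_ge0.
set M := T%:R * H%:R ^+ 2 * G H in lo.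
have TM : T%:R <= M.
  by rewrite /M -mulrA ler_peMr // mulr_ege1 // exprn_ege1.
have main : T%:R * (64 * D%:R ^+ 2) * G D <= c24 * M.
  have -> : D%:R = H%:R * 2 :> K by rewrite mulr_natr mulr2n -natrD -DH.
  have -> : T%:R * (64 * (H%:R * 2) ^+ 2) * G D
    = (T%:R * H%:R ^+ 2) * (256 * G D) by ring.
  have -> : c24 * M = (T%:R * H%:R ^+ 2) * (256 * (2 ^+ 16 * G H)).
    by rewrite /c24 /M; ring.
  by rewrite ler_wpM2l ?mulr_ge0 ?exprn_ge0 // ler_wpM2l.
set E1 := werror _ _ _ 1 in lo e1; set E4 := werror _ _ _ (4 ^ D) in up e4.
have E40 : 0 <= E4 by rewrite /E4 /werror mulr_ge0 ?exprn_even_ge0 ?mulr_ge0.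
have E10 : 0 <= E1 by rewrite /E1 /werror mulr_ge0 ?exprn_even_ge0 ?mulr_ge0.
have h1 := ler_pM (ler0n K _) E40 n2 e4.
have h2 : (c24 + 1) * E1 <= x * (2 * 1 * x ^+ 19 ^+ 2).
  by apply: ler_pM => //; rewrite addr_ge0.
have h3 : (c24 + 1) * (M - E1) <= (c24 + 1) * S.
  by rewrite ler_wpM2l // addr_ge0.
have h4 : M <= 2 * x * x * (2 * x ^+ 2 * x ^+ 19 ^+ 2)
    + x * (2 * 1 * x ^+ 19 ^+ 2) by lra.
have : x ^+ 50 <= 4 * x ^+ 42 + 2 * x ^+ 39.
  rewrite -Tx; apply: le_trans TM _; apply: le_trans h4 _.
  by rewrite le_eqVlt; apply/orP; left; apply/eqP; ring.
have x42 : 0 < x ^+ 42 by rewrite exprn_gt0 // (lt_le_trans ltr01).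
have x39 : x ^+ 39 <= x ^+ 42 by apply: ler_weXn2l.
have x8 : 8 <= x ^+ 8.
  apply: (@le_trans _ _ x); last by rewrite ler_eXnr.
  by apply: le_trans _ x32; rewrite -natrX ler_nat.
have -> : x ^+ 50 = x ^+ 42 * x ^+ 8 by rewrite -exprD.
nra.
Qed.

End Sieve.

(** * Values with few divisors *)

Section Tau.
Local Open Scope nat_scope.
Definition tau (m : nat) : nat := size (divisors m).

Lemma tauM m n : 0 < m -> 0 < n -> tau (m * n) <= tau m * tau n.
Proof.
move=> m0 n0; rewrite /tau -(size_allpairs muln).
apply: uniq_leq_size; first exact: divisors_uniq.
move=> e; rewrite -dvdn_divisors ?muln_gt0 ?m0 // => emn.
apply/allpairsP; exists (gcdn e m, e %/ gcdn e m) => /=.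
rewrite -!dvdn_divisors // dvdn_gcdr; split=> //.
  have g0 : 0 < gcdn e m by rewrite gcdn_gt0 m0 orbT.
  have [e0|e0] := posnP e.
    by move: emn; rewrite e0 dvd0n muln_eq0 !eqn0Ngt m0 n0.
  have ce : coprime (e %/ gcdn e m) (m %/ gcdn e m).
    rewrite /coprime -(eqn_pmul2l g0) muln_gcdr !muln1.
    by rewrite !(mulnC (gcdn e m)) !divnK ?dvdn_gcdl ?dvdn_gcdr.
  rewrite -(Gauss_dvdr _ ce) -(dvdn_pmul2l g0) mulnA.
  by rewrite !(mulnC (gcdn e m)) !divnK ?dvdn_gcdl ?dvdn_gcdr.
by rewrite mulnC divnK // dvdn_gcdl.
Qed.

Lemma tauX m k : 0 < m -> tau (m ^ k) <= tau m ^ k.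
Proof.
move=> m0; elim: k => [|k IH]; first by rewrite expn0.
by rewrite !expnS (leq_trans (tauM _ _)) ?expn_gt0 ?m0 // leq_mul.
Qed.

Lemma tau_prime p : prime p -> tau p <= 2.
Proof.
move=> pr; apply: (@uniq_leq_size _ (divisors p) [:: 1; p]).
  exact: divisors_uniq.
by move=> e; rewrite -dvdn_divisors ?prime_gt0 // !inE;
  case/primeP: pr => _ h /h.
Qed.

Lemma prod_primes m : 0 < m -> m = \prod_(p <- primes m) p ^ logn p m.
Proof. by move=> m0; rewrite {1}(prod_prime_decomp m0) prime_decompE big_map.
  Qed.

Lemma tau_le_exp m : 0 < m -> tau m <= 2 ^ (\sum_(p <- primes m) logn p m).
Proof.
move=> m0; rewrite {1}(prod_primes m0).
have : all prime (primes m) by apply/allP => p; rewrite mem_primes => /andP[].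
elim: (primes m) => [|p s IH] /=; first by rewrite !big_nil.
case/andP=> pr prs; rewrite !big_cons expnD.
have s0 : 0 < \prod_(j <- s) j ^ logn j m.
  rewrite big_seq; apply: prodn_cond_gt0 => q /(allP prs) /prime_gt0 q0.
  by rewrite expn_gt0 q0.
apply: leq_trans (tauM _ s0) _; first by rewrite expn_gt0 prime_gt0.
apply: leq_mul (IH prs); apply: leq_trans (tauX _ (prime_gt0 pr)) _.
by case: (logn p m) => [|k]; rewrite ?expn0 // leq_exp2r // tau_prime.
Qed.
End Tau.

(** By the small penalty, the primes up to 2^D that divide P(t) are few and
    occur once, and since |P(t)| <= 2^(102 D) at most 102 larger primes occur,
    with multiplicity. The constant depends on neither the forms nor B; this
    matters because B later grows with the number of elements of A that are to
    be separated. *)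
Lemma almost_prime_values_over (K : realFieldType) : exists C : nat,
  forall (a b c d : int) (B : nat),
  (2 %| B)%N ->
  (forall p, prime p -> ~~ (p %| B)%N ->
     [/\ (7 <= p)%N, ~~ (p%:Z %| a)%Z, ~~ (p%:Z %| c)%Z
       & ~~ (p%:Z %| a * d - b * c)%Z]) ->
  (forall p (t : nat), prime p -> (p %| B)%N ->
     ~~ (p%:Z %| (a * t%:Z + b) * (c * t%:Z + d))%Z) ->
  exists t : nat, let m := absz ((a * t%:Z + b) * (c * t%:Z + d)) in
    (0 < m)%N /\ (tau m <= C)%N.
Proof.
have exgt n : exists m, (n < m)%N by exists n.+1.
have [C0 C24] := exgt (2 ^ 24)%N.
exists (2 ^ (C0 + 102))%N => a b c d B B2 good bad.
(* D exceeds the penalty threshold C0, and both forms are at most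
   2^D * 2^(50 D) = 2^(51 D) for t < 2^(50 D). *)
set H := (25 + C0 + (`|a| + `|b| + `|c| + `|d|))%N; set D := (H + H)%N.
have D25 : (25 <= D)%N by rewrite /D /H; lia.
have DC : (C0 <= D)%N by rewrite /D /H; lia.
have [t tT pen] := exists_small_penalty K good (erefl D) D25 C24; exists t.
clear C24.
pose x := xform a b t; pose y := yform c d t.
rewrite -/(xform a b t) -/(yform c d t) -/x -/y.
set m := absz (x * y) => /=.
have badm p : prime p -> (p %| m)%N -> ~~ (p %| B)%N.
  move=> pr pm; apply/negP => pB; have := bad p t pr pB.
  by rewrite -[_ * _]/(x * y) dvdzE /= pm.
have m0 : (0 < m)%N.
  rewrite lt0n; apply/eqP => m0; have := @badm 2 isT.
  by rewrite m0 dvdn0 B2 => /(_ isT).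
split=> //; apply: leq_trans (tau_le_exp m0) _; rewrite leq_exp2l //.
have mle : (m <= 2 ^ (102 * D))%N.
  have lin (e f : int) : (`|e| + `|f| <= D)%N ->
      (absz (e * t%:Z + f)%R <= 2 ^ (51 * D))%N.
    move=> efD; have D2 : (D < 2 ^ D)%N by rewrite ltn_expl.
    have -> : (2 ^ (51 * D) = 2 ^ D * 2 ^ (50 * D))%N.
      by rewrite -expnD; congr (2 ^ _)%N; lia.
    set T := (2 ^ (50 * D))%N in tT *.
    have : (absz (e * t%:Z + f)%R <= `|e| * t + `|f|)%N by lia.
    move=> h; apply: leq_trans h _; nia.
  have -> : (2 ^ (102 * D) = 2 ^ (51 * D) * 2 ^ (51 * D))%N.
    by rewrite -expnD; congr (2 ^ _)%N; lia.
  by rewrite /m abszM leq_mul // lin // /D /H; lia.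
rewrite (bigID (fun p => (p <= 2 ^ D)%N)) /= leq_add //; last first.
  set s := (\sum_(p <- _ | _) _)%N.
  suff : (D * s <= 102 * D)%N by rewrite mulnC leq_pmul2r //; lia.
  rewrite -(@leq_exp2l 2) //; apply: leq_trans mle.
  rewrite [leqRHS](prod_primes m0) expnM /s expn_sum.
  rewrite [leqRHS](bigID (fun p => (p <= 2 ^ D)%N)) /=.
  apply: leq_trans (leq_pmull _ _).
    rewrite [leqLHS]big_seq_cond [leqRHS]big_seq_cond.
    apply: leq_prod => p /andP[_]; rewrite -ltnNge => Dp.
    by case: (logn p m) => // k; rewrite leq_exp2r // ltnW.
  rewrite big_seq_cond; apply: prodn_cond_gt0 => p /andP[].
  by rewrite mem_primes expn_gt0 => /andP[/prime_gt0 ->].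
have nosq p : prime p -> (p <= 2 ^ D)%N -> (p %| m)%N -> logn p m = 1%N.
  move=> pr pD pm; have pB := badm p pr pm.
  have lp : (0 < logn p m)%N by rewrite logn_gt0 mem_primes pr m0.
  apply/eqP; rewrite eqn_leq lp andbT leqNgt; apply/negP => l2.
  have p2m : (p ^ 2 %| m)%N by rewrite pfactor_dvdn.
  have hit2 : hit a b c d (p ^ 2) t.
    have [px|px] := boolP (p%:Z %| x)%Z.
      have py : ~~ (p%:Z %| y)%Z.
        by have := @not_both a b c d B good p t pr pB; rewrite -/x -/y px.
      rewrite /hit -/x -/y; apply/orP; left.
      rewrite dvdzE /= in py; rewrite dvdzE /=.
      by move: p2m; rewrite /m abszM Gauss_dvdl // coprimeXl // prime_coprime.
    rewrite /hit -/x -/y; apply/orP; right.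
    rewrite dvdzE /= in px; rewrite dvdzE /=.
    by move: p2m; rewrite /m abszM Gauss_dvdr // coprimeXl // prime_coprime.
  have [i spi] := sp_surj pr pB pD; rewrite -spi in hit2.
  by have := penalty_square K hit2; rewrite leNgt (lt_le_trans pen) // ler_nat.
rewrite big_seq_cond (eq_bigr (fun=> 1%N)); last first.
  by move=> p /andP[]; rewrite mem_primes => /and3P[pr _ pm] pD; apply: nosq.
rewrite -big_seq_cond sum1_count -size_filter.
have SC := le_lt_trans (penalty_card K a b c d B D t) pen.
rewrite ltr_nat in SC; apply: leq_trans (ltnW SC).
rewrite cardE -(size_map (@sp B D)).
apply: uniq_leq_size; first by rewrite filter_uniq // primes_uniq.
move=> p; rewrite mem_filter mem_primes => /and4P[pD pr _ pm].
have [i spi] := sp_surj pr (badm p pr pm) pD.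
apply/mapP; exists i => //; rewrite mem_enum inE spi.
by move: pm; rewrite /hit -/x -/y /m abszM Euclid_dvdM.
Qed.

Lemma almost_prime_values : exists C : nat,
  forall (a b c d : int) (B : nat),
  (2 %| B)%N ->
  (forall p, prime p -> ~~ (p %| B)%N ->
     [/\ (7 <= p)%N, ~~ (p%:Z %| a)%Z, ~~ (p%:Z %| c)%Z
       & ~~ (p%:Z %| a * d - b * c)%Z]) ->
  (forall p (t : nat), prime p -> (p %| B)%N ->
     ~~ (p%:Z %| (a * t%:Z + b) * (c * t%:Z + d))%Z) ->
  exists t : nat, let m := absz ((a * t%:Z + b) * (c * t%:Z + d)) in
    (0 < m)%N /\ (tau m <= C)%N.
Proof. exact: (almost_prime_values_over rat). Qed.

(** * Divisor counts in a set and the limit superior *)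

Local Open Scope classical_set_scope.

Section Counts.
Implicit Types (A : set nat) (m : nat).

Definition divisors_in A m : seq nat := [seq x <- divisors m | `[< A x >]].

Definition count_in A m : nat := size (divisors_in A m).

Lemma mem_divisors_in A m x : (0 < m)%N ->
  (x \in divisors_in A m) = `[< A x >] && (x %| m)%N.
Proof. by move=> m0; rewrite mem_filter -dvdn_divisors. Qed.

Lemma count_in_le A m (s : seq nat) : (0 < m)%N ->
  (forall x, A x -> (x %| m)%N -> x \in s) -> (count_in A m <= size s)%N.
Proof.
move=> m0 As; apply: uniq_leq_size; first by rewrite filter_uniq ?divisors_uniq.
by move=> x; rewrite mem_divisors_in // => /andP[/asboolP Ax xm]; apply: As.
Qed.

Lemma count_in_ge A m (s : seq nat) : (0 < m)%N -> uniq s ->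
  (forall x, x \in s -> A x /\ (x %| m)%N) -> (size s <= count_in A m)%N.
Proof.
move=> m0 us As; apply: uniq_leq_size => // x /As[Ax xm].
by rewrite mem_divisors_in // xm andbT; apply/asboolP.
Qed.

Lemma dvd_countE (R : realType) A (z : int) : z != 0 ->
  dvd_count R A z = (count_in A `|z|%N)%:R%:E.
Proof.
move=> z0; have z1 : (0 < `|z|)%N by rewrite absz_gt0.
rewrite /dvd_count.
have -> : [set a | A a /\ (a%:Z %| z)%Z] = [set` [fset x in divisors_in A
  `|z|%N]%fset].
  apply/seteqP; split=> x /=; rewrite in_fset /= mem_divisors_in //.
    by move=> [Ax xz]; rewrite dvdzE /= in xz; rewrite xz andbT; apply/asboolP.
  by move=> /andP[/asboolP Ax xz]; split; rewrite ?dvdzE.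
rewrite /counting asboolT; last exact: finite_fset.
rewrite set_fsetK card_fseq undup_id // filter_uniq //; exact: divisors_uniq.
Qed.

Lemma dvd_deltaE (R : realType) A (x y : int) : x != 0 -> y != 0 ->
  dvd_delta R A x y
  = (`|(count_in A `|x|%N)%:R - (count_in A `|y|%N)%:R|)%:E.
Proof.
move=> x0 y0; rewrite /dvd_delta (negPf x0) (negPf y0) /= !dvd_countE //.
Qed.

End Counts.

Section Limsup.
Variable R : realType.
Implicit Types (u : nat -> \bar R).

Lemma limn_esup_pinfty u :
  (forall N n, exists2 k, (n <= k)%N & ((N%:R : R)%:E <= u k)%E) ->
  limn_esup u = +oo%E.
Proof.
move=> ub; apply/eqP; rewrite -leye_eq;
  apply: le_ereal_inf_tmp => _ [V [n _ nV] <-].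
rewrite leye_eq; apply/eqP/eqyP => A A0.
have [N AN] : exists N : nat, A <= N%:R.
  by exists (Num.bound A); rewrite ltW // archi_boundP // ltW.
have [k nk Nk] := ub N n.
apply: (@le_trans _ _ (u k)); first by apply: le_trans Nk; rewrite lee_fin.
by apply: ereal_sup_ubound; exists k => //; apply: nV.
Qed.

Lemma limn_esup_bounded u N n :
  (forall k, (n <= k)%N -> (u k <= (N%:R : R)%:E)%E) ->
  limn_esup u != +oo%E.
Proof.
move=> ub; rewrite -ltey; apply: (@le_lt_trans _ _ (N%:R)%:E); last exact: ltry.
apply: (@le_trans _ _ (ereal_sup (u @` [set k | (n <= k)%N]))).
  by apply: ereal_inf_lbound; exists [set k | (n <= k)%N] => //; exists n.
by apply: ge_ereal_sup => _ [k nk <-]; apply: ub.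
Qed.

End Limsup.

Lemma propP_unbounded (R : realType) (F G : {poly int}) :
  (forall A : set nat, A `<=` [set a | (0 < a)%N] -> infinite_set A ->
   forall N n1 : nat, exists n : nat, [/\ (n1 < n)%N, F.[n%:Z] != 0, G.[n%:Z]
     != 0
    & (N + count_in A `|F.[n%:Z]|%N <= count_in A `|G.[n%:Z]|%N)%N \/
      (N + count_in A `|G.[n%:Z]|%N <= count_in A `|F.[n%:Z]|%N)%N]) ->
  propP R F G.
Proof.
move=> ub A A0 Ainf; apply: limn_esup_pinfty => N n1.
have [n [n1n F0 G0 cnt]] := ub A A0 Ainf N n1.
case: n n1n F0 G0 cnt => // n n1n F0 G0 cnt; exists n => //.
rewrite dvd_deltaE // lee_fin.
by case: cnt => cnt; [rewrite distrC|];
  rewrite ger0_norm ?subr_ge0 ?lerBrDr -?natrD ?ler_nat //;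
  lia.
Qed.

Lemma propP_bounded (R : realType) (F G : {poly int}) (A : set nat) (N n1 :
  nat) :
  A `<=` [set a | (0 < a)%N] -> infinite_set A ->
  (forall n : nat, (n1 < n)%N -> [/\ F.[n%:Z] != 0, G.[n%:Z] != 0,
     (count_in A `|F.[n%:Z]|%N <= count_in A `|G.[n%:Z]|%N + N)%N &
     (count_in A `|G.[n%:Z]|%N <= count_in A `|F.[n%:Z]|%N + N)%N]) ->
  ~ propP R F G.
Proof.
move=> A0 Ainf bd /(_ A A0 Ainf); apply/eqP/(@limn_esup_bounded _ _ N n1).
move=> k n1k; have [F0 G0 FG GF] := bd k.+1 n1k.
rewrite dvd_deltaE // lee_fin ler_norml.
move: FG GF; rewrite -!(ler_nat R) !natrD.
by move=> *; apply/andP; split; lra.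
Qed.

Lemma propP_sym (R : realType) F G : propP R F G -> propP R G F.
Proof.
move=> PFG A A0 Ainf; rewrite -[RHS](PFG A A0 Ainf); congr limn_esup.
apply/funext => k; rewrite /dvd_delta andbC orbC.
case: ifP => //; case: ifP => // /negbT; rewrite negb_or => /andP[x0 y0] _.
by rewrite !dvd_countE // -EFinB -EFinB /= distrC.
Qed.

(** * Local choice of the argument *)

Definition lin (e f : int) (n : nat) : int := e * n%:Z + f.

Lemma lin_neq0 e f n : e != 0 -> (`|f| < n)%N -> lin e f n != 0.
Proof. by rewrite /lin => e0 fn; apply/eqP; nia. Qed.

Lemma lin_cross e f e' f' n :
  e * lin e' f' n - e' * lin e f n = e * f' - e' * f.
Proof. by rewrite /lin; ring. Qed.

(** Two numbers cannot share more of a prime than a fixed combination r of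
    them allows: once y has a power of p that r lacks, x has no more of p
    than r. *)
Lemma pow_dvd_shared p (x y r e f : int) i j :
  e * y - f * x = r -> (p ^ i %| `|y|)%N -> ~~ (p ^ i %| `|r|)%N ->
  (p ^ j %| `|x|)%N -> (p ^ j %| `|r|)%N.
Proof.
rewrite -[(_ %| `|y|)%N]/((p ^ i)%N%:Z %| y)%Z -[(_ %| `|x|)%N]/((p ^ j)%N%:Z
  %| x)%Z.
rewrite -[(p ^ i %| `|r|)%N]/((p ^ i)%N%:Z %| r)%Z -[(_ %| `|r|)%N]/((p ^
  j)%N%:Z %| r)%Z.
move=> <- iy ir jx.
have mono a b : (a <= b)%N -> forall z, ((p ^ b)%N%:Z %| z)%Z ->
  ((p ^ a)%N%:Z %| z)%Z.
  by move=> ab z; apply: dvdz_trans; rewrite dvdzE /= dvdn_exp2l.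
have [ji|ij] := leqP j i.
  by rewrite rpredB ?dvdz_mull // (mono _ _ ji).
by case/negP: ir; rewrite rpredB ?dvdz_mull // (mono _ _ (ltnW ij)).
Qed.

Lemma pow_ndvd p k r : prime p -> (0 < r)%N -> (r < 2 ^ k)%N ->
  ~~ (p ^ k %| r)%N.
Proof.
move=> pr r0 rk; apply/negP => /(dvdn_leq r0); apply/negP; rewrite -ltnNge.
case: k rk => [|k] rk; first by rewrite expn0 in rk *.
by apply: leq_trans rk _; rewrite leq_exp2r // prime_gt1.
Qed.

Lemma pow_logn_ndvd p r : prime p -> (0 < r)%N -> ~~ (p ^ (logn p r).+1 %| r)%N.
Proof. by move=> pr r0; rewrite pfactor_dvdn // ltnn. Qed.

Lemma part_dvdP (pi : nat_pred) m E : (0 < m)%N ->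
  (forall p j, prime p -> p \in pi -> (p ^ j %| m)%N -> (p ^ j %| E)%N) ->
  (m`_pi %| E)%N.
Proof.
move=> m0 h; apply/dvdn_partP; rewrite ?part_gt0 // => p.
rewrite pi_of_part // inE => /andP[pm ppi].
have pr : prime p by move: pm; rewrite mem_primes => /andP[].
rewrite p_part; apply: h => //.
by apply: dvdn_trans (dvdn_part pi m); rewrite -p_part dvdn_part.
Qed.

Lemma pi_dvd_exp s u : \pi(u).-nat s -> (0 < u)%N -> (s %| u ^ s)%N.
Proof.
move=> su u0; have s0 : (0 < s)%N by case/andP: su.
apply/dvdn_partP => // p ps; have pu := pnatPpi su ps.
rewrite p_part; move: pu; rewrite mem_primes => /and3P[pr _ pu].
apply: (@dvdn_trans (p ^ s)); last exact: dvdn_exp2r.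
by rewrite dvdn_exp2l // ltnW // ltn_logl.
Qed.

Lemma linear_congruence (e f : int) (m : nat) :
  coprimez m e -> exists z : int, (m%:Z %| e * z + f)%Z.
Proof.
move=> /eqP cme; have [w' [w]] := Bezoutz m e; rewrite cme => bez.
exists (- w * f); have -> : e * (- w * f) + f = w' * f * m.
  by transitivity (f * 1 - e * w * f); [ring | rewrite -bez; ring].
by rewrite dvdz_mull.
Qed.

Lemma crt_linear (e1 f1 e2 f2 : int) (m1 m2 n1 : nat) :
  (0 < m1)%N -> (0 < m2)%N -> coprime m1 m2 ->
  coprimez m1 e1 -> coprimez m2 e2 ->
  exists2 n, (n1 < n)%N & (m1%:Z %| lin e1 f1 n)%Z /\ (m2%:Z %| lin e2 f2 n)%Z.
Proof.
move=> m10 m20 c12 c1 c2.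
have [z1 d1] := linear_congruence f1 c1;
  have [z2 d2] := linear_congruence f2 c2.
pose M : int := m1%:Z * m2%:Z; have M0 : 0 < M by rewrite mulr_gt0 // ltz_nat.
have cz : coprimez m1 m2 by [].
pose z := zchinese m1 m2 z1 z2.
pose n := absz ((z %% M)%Z + M * n1.+1%:Z).
have nE : n%:Z = (z %% M)%Z + M * n1.+1%:Z.
  rewrite /n gez0_abs // addr_ge0 ?modz_ge0 ?gt_eqF // mulr_ge0 // ltW //.
exists n.
  rewrite -ltz_nat nE; have : 0 <= (z %% M)%Z by rewrite modz_ge0 // gt_eqF.
  by move: M0; clear; nia.
have shift (m : nat) e f (z' : int) : (m%:Z %| e * z' + f)%Z ->
    (m%:Z %| z - z')%Z -> (m%:Z %| M)%Z -> (m%:Z %| lin e f n)%Z.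
  move=> d dz dM; have e0 := divz_eq z M.
  have -> : lin e f n
      = (e * z' + f) + e * (z - z') + e * (n1.+1%:Z - (z %/ M)%Z) * M.
    by rewrite /lin nE {2}e0; ring.
  by apply: rpredD; [apply: rpredD => //; exact: dvdz_mull | exact: dvdz_mull].
by split; apply: shift; first [eassumption | rewrite -eqz_mod_dvd; apply/eqP;
  first [exact: zchinese_modl | exact: zchinese_modr]
  | exact: dvdz_mulr | exact: dvdz_mull].
Qed.

(** The values of U can absorb any factor Y prime to u. At the primes of u the
    form L takes over; prescribing its residue modulo one more power of u fixes
    its part there. The constant cross combinations of the forms then bound the
    parts of L and V at all primes of u Y, whatever Y is. The condition
    |resLV| < 2^k keeps every p^k from dividing the resultant of L and V. *)
Section LocalChoice.
Variables (l lam u mu v nu : int).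
Hypotheses (u0 : u != 0) (cul : coprimez u l) (cumu : coprimez u mu).
Hypothesis (cuv : coprimez u v).

Definition resLU : int := l * mu - u * lam.
Definition resVU : int := v * mu - u * nu.
Definition resLV : int := l * nu - v * lam.

Lemma coprime_resLU : coprimez u resLU.
Proof.
rewrite /coprimez /resLU addrC -mulrN mulrC gcdzMDl.
by rewrite -/(coprimez _ _) coprimezMr cul.
Qed.

Lemma coprime_resVU : coprimez u resVU.
Proof.
rewrite /coprimez /resVU addrC -mulrN mulrC gcdzMDl.
by rewrite -/(coprimez _ _) coprimezMr cuv.
Qed.

Lemma local_choice (k Y n1 : nat) : (0 < Y)%N -> coprime `|u| Y ->
  resLU != 0 -> resVU != 0 -> resLV != 0 -> (`|resLV| < 2 ^ k)%N ->
  exists n, [/\ (n1 < n)%N, (Y %| `|lin u mu n|)%N,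
    (`|u| ^ k %| `|lin l lam n|)%N,
    (lin l lam n != 0 ->
       (absz (lin l lam n))`_\pi((`|u| * Y)%N) %| `|u| ^ k * `|resLU|)%N &
    (lin v nu n != 0 ->
       (absz (lin v nu n))`_\pi((`|u| * Y)%N) %| `|u| ^ k * `|resVU|)%N].
Proof.
move=> Y0 cuY R10 R20 R30 R3k.
have u1 : (0 < `|u|)%N by rewrite absz_gt0.
pose W := (Y * (`|resLU| * `|resVU|))%N.
pose Q := (`|u| ^ k.+1)%N.
have W0 : (0 < W)%N by rewrite !muln_gt0 Y0 !absz_gt0 R10.
have Q0 : (0 < Q)%N by rewrite expn_gt0 u1.
have cuW : coprime `|u| W.
  by rewrite !coprimeMr cuY; rewrite -!coprimezE coprime_resLU coprime_resVU.
have cWQ : coprime W Q by rewrite coprimeXr // coprime_sym.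
have cWu : coprimez W u by rewrite coprimezE coprime_sym.
have cQl : coprimez Q l by rewrite coprimezE coprimeXl.
have [n n1n [WU QL]] :=
  crt_linear mu (lam - (`|u| ^ k)%N%:Z) n1 W0 Q0 cWQ cWu cQl.
exists n.
have YU : (Y %| `|lin u mu n|)%N by apply: dvdn_trans WU; rewrite dvdn_mulr.
have LQ : (Q%:Z %| lin l lam n - (`|u| ^ k)%N%:Z)%Z.
  by move: QL; rewrite /lin addrA.
have ukL : (`|u| ^ k %| `|lin l lam n|)%N.
  rewrite -[(_ %| _)%N]/((`|u| ^ k)%N%:Z %| lin l lam n)%Z.
  rewrite -[lin l lam n](subrK (`|u| ^ k)%N%:Z) rpredD //.
  by apply: dvdz_trans LQ; rewrite dvdzE /= dvdn_exp2l.
(* At a prime of Y the value of U is divisible by a higher power than the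
   resultant, which pins the other form down to the resultant. *)
have atY p j (e f r : int) : prime p -> (p %| Y)%N -> r != 0 ->
    (`|r| %| `|resLU| * `|resVU|)%N -> e * mu - u * f = r ->
    (p ^ j %| `|lin e f n|)%N -> (p ^ j %| `|r|)%N.
  move=> pr pY r0 rR efr; have rr : (0 < `|r|)%N by rewrite absz_gt0.
  apply: (@pow_dvd_shared p _ (lin u mu n) _ e u (logn p `|r|).+1).
  - by rewrite lin_cross.
  - apply: dvdn_trans WU; rewrite expnS; apply: dvdn_mul => //.
    by apply: dvdn_trans rR; exact: pfactor_dvdnn.
  - exact: pow_logn_ndvd.
split=> // [L0|V0].
- apply: part_dvdP => [|p j pr]; first by rewrite absz_gt0.
  rewrite mem_primes => /and3P[_ _]; rewrite Euclid_dvdM // => /orP[pu|pY] pL.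
    apply: dvdn_mulr; set i := logn p `|u|.
    have i0 : (0 < i)%N by rewrite logn_gt0 mem_primes pr u1.
    have lk : logn p (`|u| ^ k) = (k * i)%N by rewrite lognX.
    have uk0 : (0 < `|u| ^ k)%N by rewrite expn_gt0 u1.
    rewrite pfactor_dvdn // lk leqNgt; apply/negP => kj.
    have : (p ^ (k * i).+1 %| `|u| ^ k)%N.
      rewrite -[(_ %| _)%N]/((p ^ (k * i).+1)%N%:Z %| (`|u| ^ k)%N%:Z)%Z.
      have -> : (`|u| ^ k)%N%:Z = lin l lam n - (lin l lam n - (`|u| ^ k)%N%:Z).
        by ring.
      rewrite rpredB //.
        by rewrite dvdzE /=; apply: dvdn_trans pL; rewrite dvdn_exp2l.
      apply: dvdz_trans LQ; rewrite dvdzE /= pfactor_dvdn // lognX -/i; nia.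
    by rewrite pfactor_dvdn // lk ltnn.
  by apply/dvdn_mull/(atY p j l lam resLU) => //; rewrite dvdn_mulr.
- apply: part_dvdP => [|p j pr]; first by rewrite absz_gt0.
  rewrite mem_primes => /and3P[_ _]; rewrite Euclid_dvdM // => /orP[pu|pY] pV.
    have pk : (p ^ k %| `|u| ^ k)%N by rewrite dvdn_exp2r.
    have pR := @pow_ndvd p k `|resLV| pr _ R3k.
    rewrite absz_gt0 in pR; have {}pR := pR R30.
    apply: dvdn_mulr; apply: (dvdn_trans _ pk); apply: dvdn_exp2l.
    rewrite leqNgt; apply/negP => kj.
    suff : (p ^ k %| `|resLV|)%N by apply/negP.
    have pkV : (p ^ k %| `|lin v nu n|)%N.
      by apply: dvdn_trans pV; rewrite dvdn_exp2l // ltnW.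
    apply: (@pow_dvd_shared p (lin v nu n) (lin l lam n) resLV (- v) (- l) k).
    + by rewrite /resLV /lin; ring.
    + exact: dvdn_trans pk ukL.
    + exact: pR.
    + exact: pkV.
  by apply/dvdn_mull/(atY p j v nu resVU) => //; rewrite dvdn_mull.
Qed.

End LocalChoice.

(** * Sufficiency *)

Lemma infinite_set_seq (X : set nat) N : infinite_set X ->
  exists s : seq nat, [/\ uniq s, (N <= size s)%N & forall x, x \in s -> X x].
Proof.
move=> /(infinite_set_fset N)[B BX NB]; exists B; split => [|//|x xB];
  first exact: fset_uniq.
exact: BX.
Qed.

Lemma finite_set_seq (X : set nat) : finite_set X ->
  exists s : seq nat, forall x, X x -> x \in s.
Proof. by move=> /finite_seqP[s ->]; exists s. Qed.

Lemma finite_fibers (X : set nat) (f : nat -> nat) E : (0 < E)%N ->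
  (forall s, finite_set [set a | X a /\ f a = s]) ->
  finite_set [set a | X a /\ (f a %| E)%N].
Proof.
move=> E0 fin; apply: (@sub_finite_set _ _
  (\bigcup_(s in [set` divisors E]) [set a | X a /\ f a = s])).
  move=> a [Xa fE]; exists (f a) => //=; by rewrite -dvdn_divisors.
by apply: bigcup_finite => // ; exact: finite_seq.
Qed.

Lemma count_in_tau A m : (count_in A m <= tau m)%N.
Proof. by rewrite /count_in size_filter count_size. Qed.

Lemma tau_dvd m n : (0 < n)%N -> (m %| n)%N -> (tau m <= tau n)%N.
Proof.
move=> n0 mn; apply: uniq_leq_size; first exact: divisors_uniq.
move=> e; rewrite -!dvdn_divisors //; last exact: dvdn_gt0 mn.
by move=> em; apply: dvdn_trans em mn.
Qed.

Lemma dvdn_part_split (pi : nat_pred) a m : (0 < a)%N ->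
  (a`_pi %| m)%N -> (a`_pi^' %| m)%N -> (a %| m)%N.
Proof.
by move=> a0 h1 h2; rewrite -(partnC pi a0) Gauss_dvd ?coprime_partC // h1.
Qed.

Lemma dvdn_prod_mem (s : seq nat) (f : nat -> nat) x :
  x \in s -> (f x %| \prod_(a <- s) f a)%N.
Proof. by move=> xs; rewrite (big_rem x) //= dvdn_mulr. Qed.

Definition linprod (c : int) (r1 r2 : nat) (x y : int) : int :=
  c * (x ^+ r1 * y ^+ r2).

Lemma absz_linprod c r1 r2 x y :
  absz (linprod c r1 r2 x y) = (`|c| * (`|x| ^ r1 * `|y| ^ r2))%N.
Proof. by rewrite /linprod !abszM !abszX. Qed.

Lemma linprod_neq0 c r1 r2 x y : c != 0 -> x != 0 -> y != 0 ->
  linprod c r1 r2 x y != 0.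
Proof. by move=> c0 x0 y0; rewrite !mulf_neq0 ?expf_neq0. Qed.

Lemma part_linprod_dvd pi c r1 r2 x y X Y : c != 0 -> x != 0 -> y != 0 ->
  ((absz (x))`_pi %| X)%N -> ((absz (y))`_pi %| Y)%N ->
  ((absz (linprod c r1 r2 x y))`_pi %| `|c| * (X ^ r1 * Y ^ r2))%N.
Proof.
move=> c0 x0 y0 xX yY; rewrite absz_linprod.
rewrite !partnM ?muln_gt0 ?expn_gt0 ?absz_gt0 ?c0 ?x0 ?y0 // !partnX.
by rewrite dvdn_mul ?dvdn_part // dvdn_mul // dvdn_exp2r.
Qed.

Lemma rough_part (z : int) (B : nat) : z != 0 -> (0 < B)%N ->
  exists2 w : int, z = ((absz z)`_\pi(B))%N%:Z * w
    & forall p, prime p -> (p %| B)%N -> ~~ (p %| `|w|)%N.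
Proof.
move=> z0 B0; set g := ((absz z)`_\pi(B))%N.
have /dvdzP[w zE] : (g%:Z %| z)%Z by rewrite dvdzE dvdn_part.
exists w => [|p pr pB]; first by rewrite mulrC.
have g0 : (0 < g)%N by rewrite part_gt0.
have wE : `|w|%N = ((absz z)`_\pi(B)^')%N.
  have zA : (absz z = absz w * g)%N by rewrite {1}zE abszM absz_nat.
  by apply/eqP; rewrite -(eqn_pmul2l g0) partnC ?absz_gt0 // mulnC -zA.
have wB : (\pi(B)^'.-nat `|w|)%N by rewrite wE part_pnat.
apply/negP => pw; have w0 : (0 < `|w|)%N by case/andP: wB.
have := pnatP _ w0 wB p pr pw.
by rewrite !inE /= mem_primes pr B0 pB.
Qed.

Section Sufficiency.
Variables (l lam u mu v nu gam del : int) (rL rU sL sV : nat).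
Hypotheses (l0 : l != 0) (u0 : u != 0) (v0 : v != 0).
Hypotheses (gam0 : gam != 0) (del0 : del != 0).
Hypotheses (rL0 : (0 < rL)%N) (rU0 : (0 < rU)%N).
Hypotheses (sL0 : (0 < sL)%N) (sV0 : (0 < sV)%N).
Hypotheses (cul : coprimez u l) (cumu : coprimez u mu) (cuv : coprimez u v).
Let R1 := resLU l lam u mu.
Let R2 := resVU u mu v nu.
Let R3 := resLV l lam v nu.
Hypotheses (R10 : R1 != 0) (R20 : R2 != 0) (R30 : R3 != 0).
Let Lf := lin l lam.
Let Uf := lin u mu.
Let Vf := lin v nu.
Let Ff n := linprod gam rL rU (Lf n) (Uf n).
Let Gf n := linprod del sL sV (Lf n) (Vf n).
Let piu : nat_pred := \pi(`|u|%N).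

Variable A : set nat.
Hypothesis A0 : A `<=` [set a | (0 < a)%N].

Definition separated N n1 : Prop := exists n : nat,
  [/\ (n1 < n)%N, Ff n != 0, Gf n != 0
    & (N + count_in A (absz (Ff n)) <= count_in A (absz (Gf n)))%N \/
      (N + count_in A (absz (Gf n)) <= count_in A (absz (Ff n)))%N].

Let u1 : (0 < `|u|)%N. Proof. by rewrite absz_gt0. Qed.

Lemma values_neq0 n : (`|lam| + `|mu| + `|nu| < n)%N ->
  [/\ Lf n != 0, Uf n != 0 & Vf n != 0].
Proof. by move=> h; split; apply: lin_neq0 => //; lia. Qed.

Lemma part_dvd_pow a k : (a`_piu <= k)%N -> (a`_piu %| `|u| ^ k)%N.
Proof.
move=> ak; apply: dvdn_trans (dvdn_exp2l _ ak).
by apply: pi_dvd_exp => //; apply: part_pnat.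
Qed.

Lemma dvd_values a k n : (0 < a)%N -> (a`_piu <= k)%N ->
  (`|u| ^ k %| `|Lf n|)%N -> (a`_piu^' %| `|Uf n|)%N -> (a %| absz (Ff n))%N.
Proof.
move=> a0 ak kL aU; rewrite absz_linprod dvdn_mull //.
apply: (@dvdn_part_split piu) => //.
  apply/dvdn_mulr/dvdn_exp => //.
  exact: dvdn_trans (part_dvd_pow ak) kL.
by apply/dvdn_mull/dvdn_exp.
Qed.

(** The new argument n = n0 + B g1 g2 j keeps the parts g1 of L and g2 of V at
    the primes of B constant, and the cofactors become linear forms in j to
    which the sieve applies. [B] contains the primes of 30 l v R3, so that the
    determinant B R3 of these forms is a unit at all other primes. *)
Lemma separated_part_infinite s :
  infinite_set [set a | A a /\ (a`_piu)%N = s] -> forall N n1, separated N n1.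
Proof.
move=> sinf N n1.
have [C HC] := almost_prime_values.
pose k := (s + `|R3|)%N.
have R3k : (`|R3| < 2 ^ k)%N.
  by apply: (@leq_ltn_trans k); [rewrite leq_addl | rewrite ltn_expl].
pose E0 := (`|del| * ((`|u| ^ k * `|R1|) ^ sL * (`|u| ^ k * `|R2|) ^ sV))%N.
have E00 : (0 < E0)%N.
  by rewrite !(muln_gt0, expn_gt0) !absz_gt0 del0 u0 R10 R20.
(* Neither E0 nor this bound depends on the elements of A chosen next. *)
pose bound := (tau E0 * (C ^ sL * C ^ sV))%N.
have [t [ut Nt tA]] := infinite_set_seq (N + bound)%N sinf.
(* The factor 30 puts 2, 3 and 5 into B: the sieve starts at 7. *)
pose W := (30 * `|l| * `|v| * `|R3|)%N.
have W0 : (0 < W)%N by rewrite !muln_gt0 !absz_gt0 l0 v0 R30.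
pose Y := ((\prod_(a <- t) a`_piu^') * W`_piu^')%N.
have Y0 : (0 < Y)%N by rewrite muln_gt0 part_gt0 prodn_gt0 // => a;
  apply: part_gt0.
have cuY : coprime `|u| Y.
  rewrite coprimeMr; apply/andP; split.
    elim/big_rec: _ => [|a x _ ix]; first exact: coprimen1.
    rewrite coprimeMr ix andbT coprime_pi' ?part_gt0 //; exact: part_pnat.
  rewrite coprime_pi' ?part_gt0 //; exact: part_pnat.
have [n0 [n1n YU kL partL partV]] :=
  @local_choice l lam u mu v nu u0 cul cumu cuv
  k Y (n1 + (`|lam| + `|mu| + `|nu|)) Y0 cuY R10 R20 R30 R3k.
have [L0 U0 V0] : [/\ Lf n0 != 0, Uf n0 != 0 & Vf n0 != 0].
  by apply: values_neq0; apply: leq_ltn_trans n1n; rewrite leq_addl.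
have [B BE] : exists B, B = (`|u| * Y)%N by exists (`|u| * Y)%N.
have B0 : (0 < B)%N by rewrite BE muln_gt0 u1.
have {}partL := partL L0; have {}partV := partV V0.
rewrite -BE -/R1 -/R2 in partL partV.
pose g1 := ((absz (Lf n0))`_\pi(B))%N; pose g2 := ((absz (Vf n0))`_\pi(B))%N.
have [w1 w1E w1B] := rough_part L0 B0.
have [w2 w2E w2B] := rough_part V0 B0.
rewrite -/g1 in w1E; rewrite -/g2 in w2E.
have g10 : (0 < g1)%N by rewrite part_gt0.
have g20 : (0 < g2)%N by rewrite part_gt0.
have gB z p : prime p -> ~~ (p %| B)%N -> ~~ (p %| (z`_\pi(B)))%N.
  move=> pr; apply: contra => pz.
  have := pnatP _ (part_gt0 _ _) (part_pnat \pi(B) z) p pr pz.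
  by rewrite mem_primes => /and3P[].
have WB p : prime p -> (p %| W)%N -> (p %| B)%N.
  move=> pr; rewrite -(partnC piu W0) Euclid_dvdM // => /orP[pW|pW].
    have := pnatP _ (part_gt0 _ _) (part_pnat piu W) p pr pW.
    by rewrite mem_primes BE => /and3P[_ _ pu]; rewrite dvdn_mulr.
  by rewrite BE /Y mulnA dvdn_mull.
pose a : int := l * B%:Z * g2%:Z; pose c : int := v * B%:Z * g1%:Z.
have det : a * w2 - w1 * c = B%:Z * R3.
  transitivity (B%:Z * (l * Vf n0 - v * Lf n0)); last by rewrite lin_cross.
  by rewrite w1E w2E /a /c; ring.
have B2 : (2 %| B)%N by apply: WB => //; rewrite /W -!mulnA dvdn_mulr.
have good p : prime p -> ~~ (p %| B)%N -> [/\ (7 <= p)%N, ~~ (p%:Z %| a)%Z,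
    ~~ (p%:Z %| c)%Z & ~~ (p%:Z %| a * w2 - w1 * c)%Z].
  move=> pr pB; have pW : ~~ (p %| W)%N by apply: contra pB; apply: WB.
  have [pl pv p30 pR3] : [/\ ~~ (p %| `|l|)%N, ~~ (p %| `|v|)%N,
      ~~ (p %| 30)%N & ~~ (p %| `|R3|)%N].
    by move: pW; rewrite /W !Euclid_dvdM // !negb_or => /andP[/andP[/andP[]]].
  have pM x y : ~~ (p %| x)%N -> ~~ (p %| y)%N -> ~~ (p %| x * y)%N.
    by move=> px py; rewrite Euclid_dvdM // negb_or px.
  split.
  - rewrite leqNgt; apply/negP => p7.
    have : p \in [:: 2; 3; 5].
      by move: pr p7; clear; case: p => [|[|[|[|[|[|[|p]]]]]]].
    by rewrite !inE => /or3P[] /eqP pE; move: p30; rewrite pE.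
  - by rewrite dvdzE /= !abszM !absz_nat !pM //; exact: gB.
  - by rewrite dvdzE /= !abszM !absz_nat !pM //; exact: gB.
  - by rewrite det dvdzE /= abszM absz_nat pM.
have bad p (j : nat) : prime p -> (p %| B)%N ->
    ~~ (p%:Z %| (a * j%:Z + w1) * (c * j%:Z + w2))%Z.
  move=> pr pB; have key (e w : int) : (p%:Z %| e)%Z -> ~~ (p %| `|w|)%N ->
      ~~ (p %| absz (e * j%:Z + w)%R)%N.
    move=> pe; apply: contra => h.
    rewrite -[(_ %| _)%N]/(p%:Z %| w)%Z.
    have -> : w = (e * j%:Z + w) - e * j%:Z by ring.
    by rewrite rpredB // dvdz_mulr.
  have pBz : (p%:Z %| B%:Z)%Z by [].
  rewrite dvdzE /= abszM Euclid_dvdM // negb_or !key ?w1B ?w2B //.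
    by rewrite /c dvdz_mulr // dvdz_mull.
  by rewrite /a dvdz_mulr // dvdz_mull.
have [j [xy0 tauxy]] := HC a w1 c w2 B B2 good bad.
set x := a * j%:Z + w1 in xy0 tauxy; set y := c * j%:Z + w2 in xy0 tauxy.
pose n := (n0 + B * (g1 * (g2 * j)))%N; exists n.
have Ln : Lf n = g1%:Z * x.
  have -> : Lf n = Lf n0 + l * (B * (g1 * (g2 * j)))%N%:Z.
    by rewrite /Lf /lin /n PoszD; ring.
  by rewrite w1E /x /a !PoszM; ring.
have Vn : Vf n = g2%:Z * y.
  have -> : Vf n = Vf n0 + v * (B * (g1 * (g2 * j)))%N%:Z.
    by rewrite /Vf /lin /n PoszD; ring.
  by rewrite w2E /y /c !PoszM; ring.
have [x0 y0] : (0 < `|x|)%N /\ (0 < `|y|)%N.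
  by move: xy0; rewrite abszM muln_gt0 => /andP[].
have n0n : (n0 <= n)%N by rewrite leq_addr.
have [Ln0 Un0 Vn0] : [/\ Lf n != 0, Uf n != 0 & Vf n != 0].
  by apply: values_neq0; apply: leq_trans n0n; apply: leq_ltn_trans n1n;
    rewrite leq_addl.
have Fn0 : Ff n != 0 by apply: linprod_neq0.
have Gn0 : Gf n != 0 by apply: linprod_neq0.
split=> //.
  by apply: leq_trans n0n; apply: leq_ltn_trans n1n; rewrite leq_addr.
right; apply: (@leq_trans (N + bound)).
  rewrite leq_add2l; apply: leq_trans (count_in_tau _ _) _.
  rewrite absz_linprod Ln Vn !abszM !absz_nat !expnMn.
  have -> : (`|del| * (g1 ^ sL * `|x| ^ sL * (g2 ^ sV * `|y| ^ sV))
    = (`|del| * (g1 ^ sL * g2 ^ sV)) * (`|x| ^ sL * `|y| ^ sV))%N by ring.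
  have g0 : (0 < `|del| * (g1 ^ sL * g2 ^ sV))%N.
    by rewrite !(muln_gt0, expn_gt0) absz_gt0 del0 g10 g20.
  have xx0 : (0 < `|x| ^ sL)%N by rewrite expn_gt0 x0.
  have yy0 : (0 < `|y| ^ sV)%N by rewrite expn_gt0 y0.
  apply: leq_trans (tauM g0 _) _; first by rewrite muln_gt0 xx0.
  apply: leq_mul; first by apply: tau_dvd => //;
    rewrite dvdn_mul // dvdn_mul // dvdn_exp2r.
  apply: leq_trans (tauM xx0 yy0) _.
  have tx : (tau `|x| <= C)%N.
    by apply: leq_trans tauxy; apply: tau_dvd => //; rewrite abszM dvdn_mulr.
  have ty : (tau `|y| <= C)%N.
    by apply: leq_trans tauxy; apply: tau_dvd => //; rewrite abszM dvdn_mull.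
  apply: leq_mul; (apply: leq_trans (tauX _ _) _ => //; by rewrite leq_exp2r).
apply: leq_trans Nt _; apply: count_in_ge => //; first by rewrite absz_gt0.
move=> e et; have [Ae es] := tA e et; split=> //.
have ukB : ((`|u| ^ k) %| g1)%N.
  have -> : (`|u| ^ k = (`|u| ^ k)`_\pi(B))%N.
    rewrite part_pnat_id // pnatX; apply/orP; left.
    apply/pnatP => // p pr pu; rewrite mem_primes pr B0 /=.
    by apply: dvdn_trans pu _; rewrite BE dvdn_mulr.
  by apply: partn_dvd => //; rewrite absz_gt0.
apply: (@dvd_values e k) => //.
- exact: A0.
- by rewrite es leq_addr.
- by rewrite Ln abszM absz_nat dvdn_mulr.
have -> : Uf n = Uf n0 + u * (B * (g1 * (g2 * j)))%N%:Z.
  by rewrite /Uf /lin /n PoszD; ring.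
have eY : (e`_piu^' %| Y)%N.
  by rewrite dvdn_mulr // (dvdn_prod_mem (fun a => a`_piu^')%N).
rewrite -[X in is_true X]/((e`_piu^')%N%:Z %| _)%Z rpredD //.
  by rewrite dvdzE /=; exact: dvdn_trans YU.
rewrite dvdz_mull // dvdzE /=; apply/dvdn_mulr; rewrite BE; apply/dvdn_mull.
exact: eY.
Qed.

Let E := (`|del| * (`|R1| ^ sL * `|R2| ^ sV))%N.
Let AE : set nat := [set a | A a /\ (a`_piu^' %| E)%N].

Hypothesis fin_part : forall s, finite_set [set a | A a /\ (a`_piu)%N = s].

(** With u^k dividing V(n), the u-part of L(n) divides R3 and U(n) is prime to
    u, so the elements of A dividing F(n) lie in a finite set that does not
    depend on n. *)
Lemma separated_via_G N n1 : infinite_set AE -> separated N n1.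
Proof.
move=> Einf.
pose H := (`|gam| * (`|R3| ^ rL * 1 ^ rU))%N.
have H0 : (0 < H)%N by rewrite !(muln_gt0, expn_gt0) !absz_gt0 gam0 R30.
have [c cP] := finite_set_seq (finite_fibers H0 fin_part).
have [t [ut Nt tA]] := infinite_set_seq (N + size c) Einf.
pose k := (\sum_(a <- t) a`_piu + `|R3|)%N.
have R3k : (`|R3| < 2 ^ k)%N.
  by apply: (@leq_ltn_trans k); [rewrite leq_addl | rewrite ltn_expl].
pose W := (`|R1| * `|R2|)%N.
have W0 : (0 < W)%N by rewrite muln_gt0 !absz_gt0 R10.
have uR1 := coprime_resLU lam cul cumu.
have uR2 := coprime_resVU nu cumu cuv.
have cuW : coprime `|u| W by rewrite coprimeMr -!coprimezE uR1 uR2.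
have uk0 : (0 < `|u| ^ k)%N by rewrite expn_gt0 u1.
have cWQ : coprime W (`|u| ^ k) by rewrite coprimeXr // coprime_sym.
have cWu : coprimez W u by rewrite coprimezE coprime_sym.
have cQv : coprimez (`|u| ^ k)%N v by rewrite coprimezE coprimeXl.
have [n n1n [WU ukV]] := crt_linear mu nu (n1 + (`|lam| + `|mu| + `|nu|))
  W0 uk0 cWQ cWu cQv.
rewrite dvdzE /= -/(Uf n) in WU; rewrite dvdzE /= -/(Vf n) in ukV.
have [L0 U0 V0] : [/\ Lf n != 0, Uf n != 0 & Vf n != 0].
  by apply: values_neq0; apply: leq_ltn_trans n1n; rewrite leq_addl.
have Fn0 : Ff n != 0 by apply: linprod_neq0.
have Gn0 : Gf n != 0 by apply: linprod_neq0.
have resdvd (r z e : int) : coprimez u r -> (`|r| %| W)%N ->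
    e * Uf n - u * z = r -> (`|r| %| `|z|)%N.
  move=> ur rW ez; have rdU : (r %| Uf n)%Z by rewrite dvdzE;
    apply: dvdn_trans WU.
  have : (r %| u * z)%Z.
    have -> : u * z = e * Uf n - r by rewrite -ez; ring.
    by rewrite rpredB // dvdz_mull.
  by rewrite Gauss_dvdzr // coprimez_sym.
have R1L : (`|R1| %| `|Lf n|)%N.
  by apply: (resdvd _ _ l uR1); rewrite ?dvdn_mulr ?lin_cross.
have R2V : (`|R2| %| `|Vf n|)%N.
  by apply: (resdvd _ _ v uR2); rewrite ?dvdn_mull ?lin_cross.
exists n; split=> //.
  by apply: leq_ltn_trans n1n; rewrite leq_addr.
left; apply: (@leq_trans (N + size c)).
  rewrite leq_add2l; apply: count_in_le; first by rewrite absz_gt0.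
  move=> a Aa aF; apply: cP; split=> //.
  have -> : (a`_piu = a`_piu`_piu)%N by rewrite [RHS]part_pnat_id // part_pnat.
  have aF' : (a`_piu %| absz (Ff n))%N by apply: dvdn_trans aF;
    apply: dvdn_part.
  apply: dvdn_trans (partn_dvd _ _ aF') _; first by rewrite absz_gt0.
  apply: part_linprod_dvd => //.
    apply: part_dvdP => [|p j pr pu pL]; first by rewrite absz_gt0.
    have {}pu : (p %| `|u|)%N by move: pu; rewrite mem_primes => /and3P[].
    apply: (@pow_dvd_shared p (Lf n) (Vf n) R3 l v k) => //.
    - exact: lin_cross.
    - by apply: dvdn_trans ukV; apply: dvdn_exp2r.
    - by apply: pow_ndvd; rewrite ?absz_gt0.
  rewrite part_p'nat //; apply/pnatP => [|p pr pU]; first by rewrite absz_gt0.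
  apply/negP; rewrite mem_primes => /and3P[_ _ pu].
  have : (p%:Z %| mu)%Z.
    have -> : mu = Uf n - u * n%:Z by rewrite /Uf /lin; ring.
    by rewrite rpredB // dvdz_mulr.
  move=> pmu; have : (p%:Z %| gcdz u mu)%Z by rewrite dvdz_gcd pmu andbT.
  by rewrite (eqP cumu) dvdzE /= dvdn1 => /eqP p1; rewrite p1 in pr.
apply: leq_trans Nt _; apply: count_in_ge => //; first by rewrite absz_gt0.
move=> a at_; have [Aa aE] := tA a at_; split=> //.
apply: (@dvdn_part_split piu); first exact: A0.
  rewrite absz_linprod dvdn_mull // dvdn_mull // dvdn_exp //.
  apply: dvdn_trans ukV; apply: part_dvd_pow.
  by rewrite /k (big_rem a) //= -!addnA leq_addr.
apply: dvdn_trans aE _; rewrite absz_linprod.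
by rewrite dvdn_mul // dvdn_mul // dvdn_exp2r.
Qed.

(** Once the power u^k is fixed, the possible u-parts of G(n) are limited, so
    only a finite list d of elements of A can divide G(n). Putting the rest of
    each of them into U(n) leaves in G(n), at those primes, no more than E. *)
Lemma separated_via_F N n1 : finite_set AE -> infinite_set A -> separated N n1.
Proof.
move=> /finite_set_seq[c cP] Ainf.
have [t [ut Nt tA]] := infinite_set_seq (N + size c) Ainf.
pose k := (\sum_(a <- t) a`_piu + `|R3|)%N.
have R3k : (`|R3| < 2 ^ k)%N.
  by apply: (@leq_ltn_trans k); [rewrite leq_addl | rewrite ltn_expl].
pose H := (`|del| * ((`|u| ^ k * `|R1|) ^ sL * (`|u| ^ k * `|R2|) ^ sV))%N.
have H0 : (0 < H)%N.
  by rewrite !(muln_gt0, expn_gt0) !absz_gt0 del0 u0 R10 R20.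
have [d dP] := finite_set_seq (finite_fibers H0 fin_part).
pose Y := (\prod_(a <- t ++ d) a`_piu^')%N.
have Y0 : (0 < Y)%N by rewrite prodn_gt0 // => a; apply: part_gt0.
have cuY : coprime `|u| Y.
  rewrite /Y; elim/big_rec: _ => [|a x _ ix]; first exact: coprimen1.
  rewrite coprimeMr ix andbT coprime_pi' ?part_gt0 //; exact: part_pnat.
have [n [n1n YU kL partL partV]] :=
  @local_choice l lam u mu v nu u0 cul cumu cuv
  k Y (n1 + (`|lam| + `|mu| + `|nu|)) Y0 cuY R10 R20 R30 R3k.
have [L0 U0 V0] : [/\ Lf n != 0, Uf n != 0 & Vf n != 0].
  by apply: values_neq0; apply: leq_ltn_trans n1n; rewrite leq_addl.
have Fn0 : Ff n != 0 by apply: linprod_neq0.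
have Gn0 : Gf n != 0 by apply: linprod_neq0.
have partG : ((absz (Gf n))`_\pi((`|u| * Y)%N) %| H)%N.
  by apply: part_linprod_dvd => //; [apply: partL | apply: partV].
have uY0 : (0 < `|u| * Y)%N by rewrite muln_gt0 u1.
exists n; split=> //.
  by apply: leq_ltn_trans n1n; rewrite leq_addr.
right; apply: (@leq_trans (N + size c)).
  rewrite leq_add2l; apply: count_in_le; first by rewrite absz_gt0.
  move=> a Aa aG; apply: cP; split=> //.
  have a0 : (0 < a)%N := A0 Aa.
  have reduce b : (0 < b)%N -> (b %| absz (Gf n))%N ->
      (forall p, prime p -> (p %| b)%N -> (p %| `|u| * Y)%N) -> (b %| H)%N.
    move=> b0 bG bp; apply: dvdn_trans partG.
    have -> : b = (b`_\pi((`|u| * Y)%N))%N.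
      rewrite [RHS]part_pnat_id //; apply/pnatP => // p pr pb.
      by rewrite mem_primes pr uY0 bp.
    by apply: partn_dvd => //; rewrite absz_gt0.
  have apiu p : prime p -> (p %| a`_piu)%N -> (p %| `|u|)%N.
    move=> pr pa; have := pnatP _ (part_gt0 _ _) (part_pnat piu a) p pr pa.
    by rewrite mem_primes => /and3P[].
  have auH : (a`_piu %| H)%N.
    apply: reduce; rewrite ?part_gt0 //.
      by apply: dvdn_trans aG; apply: dvdn_part.
    by move=> p pr pa; rewrite dvdn_mulr // apiu.
  have ad : a \in d by apply: dP.
  have aY : (a`_piu^' %| Y)%N.
    by apply: (dvdn_prod_mem (fun b => b`_piu^')%N); rewrite mem_cat ad orbT.
  have aH : (a`_piu^' %| H)%N.
    apply: reduce; rewrite ?part_gt0 //.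
      by apply: dvdn_trans aG; apply: dvdn_part.
    by move=> p pr pa; rewrite dvdn_mull // (dvdn_trans pa).
  have cau : coprime (a`_piu^')%N (`|u|)%N.
    by rewrite coprime_sym coprime_pi' ?part_gt0 ?part_pnat.
  move: aH; rewrite /H !expnMn.
  have -> : (`|del| * ((`|u| ^ k) ^ sL * `|R1| ^ sL * ((`|u| ^ k) ^ sV * `|R2|
    ^ sV))
    = ((`|u| ^ k) ^ sL * (`|u| ^ k) ^ sV) * E)%N by rewrite /E; ring.
  by rewrite Gauss_dvdr // coprimeMr !coprimeXr.
apply: leq_trans Nt _; apply: count_in_ge => //; first by rewrite absz_gt0.
move=> a at_; split; first exact: tA.
apply: (@dvd_values a k) => //.
- exact/A0/tA.
- by rewrite /k (big_rem a) //= -!addnA leq_addr.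
apply: dvdn_trans YU; apply: (dvdn_prod_mem (fun b => b`_piu^')%N).
by rewrite mem_cat at_.
Qed.

End Sufficiency.

Lemma separated_infinite (l lam u mu v nu gam del : int) (rL rU sL sV : nat)
    (A : set nat) :
  l != 0 -> u != 0 -> v != 0 -> gam != 0 -> del != 0 ->
  (0 < rL)%N -> (0 < rU)%N -> (0 < sL)%N -> (0 < sV)%N ->
  coprimez u l -> coprimez u mu -> coprimez u v ->
  resLU l lam u mu != 0 -> resVU u mu v nu != 0 -> resLV l lam v nu != 0 ->
  A `<=` [set a | (0 < a)%N] -> infinite_set A ->
  forall N n1, separated l lam u mu v nu gam del rL rU sL sV A N n1.
Proof.
move=> l0 u0 v0 gam0 del0 rL0 rU0 sL0 sV0 cul cumu cuv R10 R20 R30 A0 Ainf N n1.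
have [[s sinf]|nsinf] := pselect (exists s,
    infinite_set [set a | A a /\ (a`_(\pi(`|u|%N)))%N = s]).
  by apply: separated_part_infinite sinf _ _.
have fin s : finite_set [set a | A a /\ (a`_(\pi(`|u|%N)))%N = s].
  by apply: contrapT => sinf; apply: nsinf; exists s.
have [AEfin|AEinf] := pselect (finite_set [set a | A a /\
    (a`_((\pi(`|u|%N))^') %| `|del| * (`|resLU l lam u mu| ^ sL * `|resVU u mu
      v nu| ^ sV))%N]).
  by apply: separated_via_F.
by apply: separated_via_G.
Qed.

(** * Necessity *)

Lemma infinite_range (f : nat -> nat) : (forall k, (k < f k)%N) ->
  infinite_set (range f).
Proof.
move=> fk /finite_set_seq[s sP]; pose k := (\sum_(x <- s) x)%N.
have : f k \in s by apply: sP; exists k.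
have mem_le x : x \in s -> (x <= k)%N.
  by move=> xs; rewrite /k (big_rem x) //= leq_addr.
by move=> /mem_le; rewrite leqNgt fk.
Qed.

Lemma coprime_linear (g l lam : int) (n : int) :
  (g %| l)%Z -> coprimez l lam -> coprimez g (l * n + lam).
Proof.
move=> /dvdzP[q ->]; rewrite coprimezMl => /andP[_ cg].
by rewrite /coprimez mulrAC gcdzMDl.
Qed.

Section Necessity.
Variables (l lam u mu v nu gam del : int) (rL rU sL sV : nat).
Hypotheses (l0 : l != 0) (u0 : u != 0) (v0 : v != 0).
Hypotheses (gam0 : gam != 0) (del0 : del != 0).
Hypotheses (cl : coprimez l lam) (cu : coprimez u mu) (cv : coprimez v nu).

Lemma count_powers (b g c : nat) (r1 r2 : nat) (x y z : int) :
  (1 < g)%N -> (g %| b)%N -> z != 0 -> x != 0 -> y != 0 ->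
  coprime g `|x| -> coprime g `|y| ->
  (count_in (range (fun k => b ^ k.+1)%N) (absz (linprod z r1 r2 x y)) <=
    `|z|)%N.
Proof.
move=> g1 gb z0 x0 y0 gx gy.
rewrite -[leqRHS](size_iota 0) -(size_map (fun k => b ^ k.+1)%N).
apply: count_in_le; first by rewrite absz_gt0 linprod_neq0.
move=> _ [k _ <-] bk; apply: map_f; rewrite mem_iota /= add0n.
have : (g ^ k.+1 %| `|z|)%N.
  have : (g ^ k.+1 %| absz (linprod z r1 r2 x y))%N.
    by apply: dvdn_trans bk; apply: dvdn_exp2r.
  by rewrite absz_linprod Gauss_dvdl // coprimeXl // coprimeMr !coprimeXr.
move=> /dvdn_leq; rewrite absz_gt0 => /(_ z0); apply: leq_trans.
by apply: ltnW; apply: ltn_expl.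
Qed.

(** Apart from p itself, each p^(c^(i+1)) dividing X is the c-th power of an
    element dividing Y: the exponent c^(i+1) is at most va + r t <= c t, so
    c^i <= t. When t = 0 the valuation of X is the constant va. *)
Lemma sparse_count (p c X Y va vb r s t : nat) : prime p -> (1 < c)%N ->
  (0 < X)%N -> (0 < Y)%N -> logn p X = (va + r * t)%N ->
  logn p Y = (vb + s * t)%N -> (0 < s)%N -> (va + r <= c)%N ->
  (count_in (range (fun i => p ^ (c ^ i))%N) X
   <= count_in (range (fun i => p ^ (c ^ i))%N) Y + va.+1)%N.
Proof.
move=> pr c1 X0 Y0 lX lY s0 cr.
have [t0|t0] := posnP t.
  apply: (@leq_trans va); last by rewrite addnS -addSn leq_addl.
  rewrite -[leqRHS](size_iota 0) -(size_map (fun i => p ^ (c ^ i))%N).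
  apply: count_in_le => // _ [i _ <-];
    rewrite pfactor_dvdn // lX t0 muln0 addn0.
  move=> ci; apply: map_f; rewrite mem_iota add0n /=.
  exact: leq_trans (ltn_expl _ c1) ci.
apply: (@leq_trans (count_in (range (fun i => p ^ (c ^ i))%N) Y).+1);
  last by lia.
have -> : (count_in (range (fun i => p ^ (c ^ i))%N) Y).+1 = size (p ::
    [seq (a ^ c)%N | a <- divisors_in (range (fun i => p ^ (c ^ i))%N) Y]).
  by rewrite /= size_map.
apply: count_in_le => // _ [i _ <-].
rewrite pfactor_dvdn // lX => ci; case: i ci => [|i] ci.
  by rewrite expn0 expn1 mem_head.
rewrite inE; apply/orP; right; rewrite expnSr expnM; apply: map_f.
rewrite mem_divisors_in //; apply/andP; split; first by apply/asboolP; exists i.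
rewrite pfactor_dvdn // lY.
have : (c ^ i.+1 <= c * t)%N by nia.
rewrite expnS leq_pmul2l; [nia | lia].
Qed.

Let Ff (n : nat) := linprod gam rL rU (lin l lam n) (lin u mu n).
Let Gf (n : nat) := linprod del sL sV (lin l lam n) (lin v nu n).

Definition count_bounded (A : set nat) : Prop := exists N n1 : nat,
  forall n : nat, (n1 < n)%N -> [/\ Ff n != 0, Gf n != 0,
     (count_in A (absz (Ff n)) <= count_in A (absz (Gf n)) + N)%N &
     (count_in A (absz (Gf n)) <= count_in A (absz (Ff n)) + N)%N].

Let values_neq0 n : (`|lam| + `|mu| + `|nu| < n)%N ->
  [/\ lin l lam n != 0, lin u mu n != 0 & lin v nu n != 0].
Proof. by move=> h; split; apply: lin_neq0 => //; lia. Qed.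

Lemma bounded_powers : (1 < gcdn `|l| `|u|)%N -> (1 < gcdn `|l| `|v|)%N ->
  count_bounded (range (fun k => (gcdn `|l| `|u| * gcdn `|l| `|v|) ^ k.+1)%N).
Proof.
set g := gcdn _ _; set h := gcdn _ _ => g1 h1.
exists (`|gam| + `|del|)%N, (`|lam| + `|mu| + `|nu|)%N =>
  n /values_neq0[L0 U0 V0].
have cop (d : nat) (e f : int) : (d %| `|e|)%N -> coprimez e f ->
  coprime d (absz (lin e f n)).
  by move=> de ef; have := @coprime_linear d e f n%:Z de ef; rewrite coprimezE.
split; try exact: linprod_neq0.
  apply: leq_trans (_ : `|gam| <= _)%N; last by lia.
  apply: (@count_powers _ g) => //;
    rewrite ?dvdn_mulr // cop ?dvdn_gcdl ?dvdn_gcdr //.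
apply: leq_trans (_ : `|del| <= _)%N; last by lia.
by apply: (@count_powers _ h) => //;
  rewrite ?dvdn_mull // cop ?dvdn_gcdl ?dvdn_gcdr.
Qed.

Lemma bounded_sparse p : prime p -> (p %| `|u|)%N -> (p %| `|v|)%N ->
  (0 < rL)%N -> (0 < sL)%N ->
  count_bounded (range (fun i => p ^ ((`|gam| + `|del| + rL + sL) ^ i))%N).
Proof.
move=> pr pu pv rL0 sL0; set c := (_ + _)%N.
have gam1 : (0 < `|gam|)%N by rewrite absz_gt0.
have del1 : (0 < `|del|)%N by rewrite absz_gt0.
exists (`|gam| + `|del|)%N, (`|lam| + `|mu| + `|nu|)%N =>
  n /values_neq0[L0 U0 V0].
have Fn0 : Ff n != 0 by apply: linprod_neq0.
have Gn0 : Gf n != 0 by apply: linprod_neq0.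
have unit_at (e f : int) : (p %| `|e|)%N -> coprimez e f ->
  logn p (absz (lin e f n)) = 0%N.
  move=> pe ef; have := @coprime_linear p e f n%:Z pe ef.
  rewrite coprimezE /= prime_coprime // => np.
  by rewrite lognE (negPf np) !andbF.
have val z r1 r2 x y : z != 0 -> x != 0 -> y != 0 -> logn p (absz y) = 0%N ->
    logn p (absz (linprod z r1 r2 x y)) = (logn p `|z| + r1 * logn p `|x|)%N.
  move=> z0 x0 y0 ly; rewrite absz_linprod !lognM ?muln_gt0 ?expn_gt0 ?absz_gt0
    ?x0 ?y0 //.
  by rewrite !lognX ly muln0 addn0.
have lF := val _ rL rU _ _ gam0 L0 U0 (unit_at u mu pu cu).
have lG := val _ sL sV _ _ del0 L0 V0 (unit_at v nu pv cv).
have lg : (logn p `|gam| < `|gam|)%N by rewrite ltn_logl.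
have ld : (logn p `|del| < `|del|)%N by rewrite ltn_logl.
have c1 : (1 < c)%N by rewrite /c; clear -gam1 del1 rL0; lia.
have cF : (logn p `|gam| + rL <= c)%N by rewrite /c; clear -lg; lia.
have cG : (logn p `|del| + sL <= c)%N by rewrite /c; clear -ld; lia.
have F1 : (0 < absz (Ff n))%N by rewrite absz_gt0.
have G1 : (0 < absz (Gf n))%N by rewrite absz_gt0.
have FG := sparse_count pr c1 F1 G1 lF lG sL0 cF.
have GF := sparse_count pr c1 G1 F1 lG lF rL0 cG.
split=> //.
  by apply: leq_trans FG _; rewrite leq_add2l; clear -lg; lia.
by apply: leq_trans GF _; rewrite leq_add2l; clear -ld; lia.
Qed.

End Necessity.

(** * Linear polynomials and intersectivity *)

Lemma primitive_linear (e f : int) : primitive (e *: 'X + f%:P) -> coprimez e f.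
Proof.
rewrite /primitive => prim; rewrite /coprimez.
have : (gcdz e f %| zcontents (e *: 'X + f%:P))%Z.
  rewrite dvdz_contents; apply/polyOverP => i.
  rewrite coefD coefZ coefX coefC; apply: rpredD.
    by rewrite dvdz_mulr // dvdz_gcdl.
  by case: i => [|i] /=; rewrite ?dvdz_gcdr ?dvdz0.
rewrite dvdzE prim dvdn1 => /eqP h.
by rewrite -[gcdz e f]gez0_abs ?h // /gcdz.
Qed.

Lemma nonconstant_linear (e f : int) : nonconstant (e *: 'X + f%:P) -> e != 0.
Proof.
apply: contraTneq => ->; rewrite /nonconstant scale0r add0r -leqNgt.
exact: size_polyC_leq1.
Qed.

(** If the cross term vanishes, the leading coefficients divide each other by
    primitivity, so they agree up to sign, and then so do the constant terms. *)
Lemma nonassociate_linear (e f e' f' : int) : e != 0 ->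
  coprimez e f -> coprimez e' f' ->
  ~ associate (e *: 'X + f%:P) (e' *: 'X + f'%:P) -> e * f' - e' * f != 0.
Proof.
move=> e0 cef cef' nass; apply/eqP => /eqP; rewrite subr_eq0 => /eqP eq.
have d1 : (e %| e')%Z by rewrite -(Gauss_dvdzl _ cef) -eq dvdz_mulr.
have d2 : (e' %| e)%Z by rewrite -(Gauss_dvdzl _ cef') eq dvdz_mulr.
have ee : `|e|%N = `|e'|%N by apply/eqP; rewrite eqn_dvd -!dvdzE d1.
have [h|h] : e = e' \/ e = - e' by (clear -ee; lia).
all: apply: nass.
  left; move: eq; rewrite h => /mulfI -> //; by rewrite -h.
have e'0 : e' != 0 by move: e0; rewrite h oppr_eq0.
right; move: eq; rewrite h mulNr -mulrN => /(mulfI e'0) <-.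
by rewrite opprD -scaleNr polyCN.
Qed.

Lemma horner_linprod (z e f e' f' n : int) r1 r2 :
  (z *: ((e *: 'X + f%:P) ^+ r1 * (e' *: 'X + f'%:P) ^+ r2)).[n]
  = linprod z r1 r2 (e * n + f) (e' * n + f').
Proof. by rewrite /linprod !(hornerE, horner_exp). Qed.

Lemma intersective_linprod (z e f e' f' : int) r1 r2 : z != 0 ->
  e != 0 -> e' != 0 -> coprimez e f -> coprimez e' f' ->
  (0 < r1)%N -> (0 < r2)%N ->
  (intersective (z *: ((e *: 'X + f%:P) ^+ r1 * (e' *: 'X + f'%:P) ^+ r2))
   <-> gcdn `|e| `|e'| = 1%N).
Proof.
move=> z0 e0 e'0 cef cef' r10 r20; split=> [inter|cee' m m0].
  apply/eqP; apply: contraT => ncop.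
  have g0 : (0 < gcdn `|e| `|e'|)%N by rewrite gcdn_gt0 absz_gt0 e0.
  have [p pr pg] : exists2 p, prime p & (p %| gcdn `|e| `|e'|)%N.
    exists (pdiv (gcdn `|e| `|e'|)); last exact: pdiv_dvd.
    by rewrite pdiv_prime // ltn_neqAle eq_sym ncop.
  move: pg; rewrite dvdn_gcd => /andP[pe pe'].
  have pz : (0 < p ^ `|z|)%N by rewrite expn_gt0 prime_gt0.
  have [n] := inter _ pz; rewrite horner_linprod dvdzE absz_linprod /=.
  have cop (x y : int) : (p %| `|x|)%N -> coprimez x y ->
      coprime (p ^ `|z|) (absz (x * n + y)%R).
    move=> px xy; apply: coprimeXl.
    by have := @coprime_linear p x y n px xy; rewrite coprimezE.
  rewrite Gauss_dvdl; last by rewrite coprimeMr !coprimeXr ?cop.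
  move=> /dvdn_leq; rewrite absz_gt0 => /(_ z0); rewrite leqNgt => /negP[].
  by apply: ltn_expl; apply: prime_gt1.
have c1 : coprimez (m`_(\pi(`|e|%N))^')%N e.
  by rewrite coprimezE coprime_sym coprime_pi' ?part_gt0 ?absz_gt0 // part_pnat.
have c2 : coprimez (m`_\pi(`|e|%N))%N e'.
  rewrite coprimezE; apply: (@pnat_coprime \pi(`|e|%N)); first exact: part_pnat.
  by rewrite -coprime_pi' ?absz_gt0 //; apply/eqP.
have c12 : coprime (m`_(\pi(`|e|%N))^')%N (m`_\pi(`|e|%N))%N.
  by rewrite coprime_sym coprime_partC.
have [n _ [d1 d2]] := crt_linear f f' 0 (part_gt0 _ _) (part_gt0 _ _) c12 c1 c2.
exists n%:Z; rewrite horner_linprod dvdzE absz_linprod dvdn_mull //.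
rewrite -{1}(partnC \pi(`|e|%N) m0) mulnC.
by rewrite dvdn_mul // dvdn_exp.
Qed.

Section Final.
Variables (R : realType) (l lam u mu v nu gam del : int) (rL rU sL sV : nat).
Hypotheses (l0 : l != 0) (u0 : u != 0) (v0 : v != 0).
Hypotheses (gam0 : gam != 0) (del0 : del != 0).
Hypotheses (rL0 : (0 < rL)%N) (rU0 : (0 < rU)%N).
Hypotheses (sL0 : (0 < sL)%N) (sV0 : (0 < sV)%N).
Hypotheses (cl : coprimez l lam) (cu : coprimez u mu) (cv : coprimez v nu).
Let F : {poly int} :=
  gam *: ((l *: 'X + lam%:P) ^+ rL * (u *: 'X + mu%:P) ^+ rU).
Let G : {poly int} :=
  del *: ((l *: 'X + lam%:P) ^+ sL * (v *: 'X + nu%:P) ^+ sV).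

Lemma propP_coprime :
  l * mu - u * lam != 0 -> v * mu - u * nu != 0 -> l * nu - v * lam != 0 ->
  coprimez u l -> coprimez u v -> propP R F G.
Proof.
move=> R1 R2 R3 cul cuv; apply: propP_unbounded => A A0 Ainf N n1.
have [n [n1n F0 G0 cnt]] := @separated_infinite l lam u mu v nu gam del rL rU
  sL sV A
  l0 u0 v0 gam0 del0 rL0 rU0 sL0 sV0 cul cu cuv R1 R2 R3 A0 Ainf N n1.
by exists n; rewrite !horner_linprod.
Qed.

Lemma not_propP_count A : A `<=` [set a | (0 < a)%N] -> infinite_set A ->
  count_bounded l lam u mu v nu gam del rL rU sL sV A -> ~ propP R F G.
Proof.
move=> A0 Ainf [N [n1 bd]]; apply: (propP_bounded (N := N) (n1 := n1) A0 Ainf).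
by move=> n /bd[F0 G0 FG GF]; rewrite !horner_linprod.
Qed.

Lemma propP_necessary : propP R F G ->
  gcdn `|u| `|v| = 1%N /\ minn (gcdn `|l| `|u|) (gcdn `|l| `|v|) = 1%N.
Proof.
move=> PFG.
have l1 : (0 < `|l|)%N by rewrite absz_gt0.
have u1 : (0 < `|u|)%N by rewrite absz_gt0.
have min1 : minn (gcdn `|l| `|u|) (gcdn `|l| `|v|) = 1%N.
  have g0 : (0 < gcdn `|l| `|u|)%N by rewrite gcdn_gt0 l1.
  have h0 : (0 < gcdn `|l| `|v|)%N by rewrite gcdn_gt0 l1.
  have [g1|g1] := ltnP 1 (gcdn `|l| `|u|); last by lia.
  have [h1|h1] := ltnP 1 (gcdn `|l| `|v|); last by lia.
  have cb : count_bounded l lam u mu v nu gam del rL rU sL sV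
    (range (fun k => (gcdn `|l| `|u| * gcdn `|l| `|v|) ^ k.+1)%N).
    exact: bounded_powers.
  case: (not_propP_count _ _ cb PFG).
    by move=> _ [k _ <-] /=; rewrite expn_gt0 muln_gt0 g0 h0.
  apply: infinite_range => k; apply: ltnW; apply: ltn_expl.
  by rewrite (leq_trans g1) // leq_pmulr.
split=> //; apply/eqP; apply: contraT => ncop.
have g0 : (0 < gcdn `|u| `|v|)%N by rewrite gcdn_gt0 u1.
have [p pr pg] : exists2 p, prime p & (p %| gcdn `|u| `|v|)%N.
  exists (pdiv (gcdn `|u| `|v|)); last exact: pdiv_dvd.
  by rewrite pdiv_prime // ltn_neqAle eq_sym ncop.
move: pg; rewrite dvdn_gcd => /andP[pu pv].
have cb : count_bounded l lam u mu v nu gam del rL rU sL sV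
  (range (fun i => p ^ ((`|gam| + `|del| + rL + sL) ^ i))%N).
  exact: bounded_sparse.
case: (not_propP_count _ _ cb PFG).
  by move=> _ [k _ <-] /=; rewrite expn_gt0 prime_gt0.
apply: infinite_range => k;
  apply: (@ltn_trans ((`|gam| + `|del| + rL + sL) ^ k)).
  apply: ltn_expl; have : (0 < `|gam|)%N by rewrite absz_gt0.
  by lia.
by apply: ltn_expl; apply: prime_gt1.
Qed.
End Final.

(** * The theorem *)

Theorem theorem1p5 (R : realType) (l lam u mu v nu : int)
    (L U V F G : {poly int}) (gam del : int) (rL rU sL sV : nat)
    (defL : L = l *: 'X + lam%:P)
    (defU : U = u *: 'X + mu%:P)
    (defV : V = v *: 'X + nu%:P)
    (primL : primitive L) (primU : primitive U) (primV : primitive V)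
    (ncL : nonconstant L) (ncU : nonconstant U) (ncV : nonconstant V)
    (nassLU : ~ associate L U) (nassLV : ~ associate L V)
    (nassUV : ~ associate U V)
    (gam_neq0 : gam != 0) (del_neq0 : del != 0)
    (rL_gt0 : (0 < rL)%N) (rU_gt0 : (0 < rU)%N)
    (sL_gt0 : (0 < sL)%N) (sV_gt0 : (0 < sV)%N)
    (defF : F = gam *: (L ^+ rL * U ^+ rU))
    (defG : G = del *: (L ^+ sL * V ^+ sV)) :
  (propP R F G <->
     gcdn `|u|%N `|v|%N = 1%N /\
     minn (gcdn `|l|%N `|u|%N) (gcdn `|l|%N `|v|%N) = 1%N)
  /\
  (propP R F G <->
     intersective (U * V) /\ (intersective F \/ intersective G)).
Proof.
have l0 : l != 0 by apply: (@nonconstant_linear l lam); rewrite -defL.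
have u0 : u != 0 by apply: (@nonconstant_linear u mu); rewrite -defU.
have v0 : v != 0 by apply: (@nonconstant_linear v nu); rewrite -defV.
have cl : coprimez l lam by apply: primitive_linear; rewrite -defL.
have cu : coprimez u mu by apply: primitive_linear; rewrite -defU.
have cv : coprimez v nu by apply: primitive_linear; rewrite -defV.
have resLU0 : l * mu - u * lam != 0.
  by apply: (nonassociate_linear l0 cl cu); rewrite -defL -defU.
have resLV0 : l * nu - v * lam != 0.
  by apply: (nonassociate_linear l0 cl cv); rewrite -defL -defV.
have resVU0 : v * mu - u * nu != 0.
  rewrite -oppr_eq0 opprB.
  by apply: (nonassociate_linear u0 cu cv); rewrite -defU -defV.
have resUV0 : u * nu - v * mu != 0 by rewrite -oppr_eq0 opprB.
have mainE : propP R F G <-> gcdn `|u|%N `|v|%N = 1%N /\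
    minn (gcdn `|l|%N `|u|%N) (gcdn `|l|%N `|v|%N) = 1%N.
  rewrite defF defG defL defU defV; split; first exact: propP_necessary.
  case=> /eqP cuv min1; have cuvz : coprimez u v by [].
  have l1 : (0 < `|l|)%N by rewrite absz_gt0.
  have g0 : (0 < gcdn `|l| `|u|)%N by rewrite gcdn_gt0 l1.
  have h0 : (0 < gcdn `|l| `|v|)%N by rewrite gcdn_gt0 l1.
  have [/eqP g1|/eqP h1] : gcdn `|l| `|u| = 1%N \/ gcdn `|l| `|v| = 1%N by lia.
    by apply: propP_coprime => //; rewrite coprimez_sym.
  apply: propP_sym; apply: propP_coprime => //; rewrite coprimez_sym //.
have interUV : intersective (U * V) <-> gcdn `|u| `|v| = 1%N.
  have := @intersective_linprod 1 u mu v nu 1 1 isT u0 v0 cu cv isT isT.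
  by rewrite scale1r !expr1 -defU -defV.
have interF : intersective F <-> gcdn `|l| `|u| = 1%N.
  by rewrite defF defL defU; apply: intersective_linprod.
have interG : intersective G <-> gcdn `|l| `|v| = 1%N.
  by rewrite defG defL defV; apply: intersective_linprod.
split=> //; rewrite mainE interUV interF interG.
have l1 : (0 < `|l|)%N by rewrite absz_gt0.
have g0 : (0 < gcdn `|l| `|u|)%N by rewrite gcdn_gt0 l1.
have h0 : (0 < gcdn `|l| `|v|)%N by rewrite gcdn_gt0 l1.
split=> -[-> h]; split=> //; lia.
Qed.
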